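(* Let $\mathbb X$ and $\mathbb Y$ be (real or complex) Hilbert spaces, $\Omega\subseteq\mathbb X$ an open set, and $F:\Omega\to\mathbb Y$ a continuously differentiable function such that $F'$ has a closed image in $\Omega$ (that is, $F'(x)$ has closed image for every $x\in\Omega$). Let $x_*\in\Omega$, $R>0$, $\beta:=\|F'(x_* )^{\dagger}\|$ and $\kappa:=\sup\{t\in[0,R): B(x_*,t)\subset\Omega\}$. Suppose that $F(x_* )=0$, that $F'(x_* )$ is injective, and that there exist constants $K>0$ and $0<p\le1$ such that $$\beta\,\|F'(x)-F'(x_*+\tau(x-x_* ))\|\le K(1-\tau^p)\|x-x_*\|^p,\qquad x\in B(x_*,\kappa),\ \tau\in[0,1].$$ Let $r=\min\{\kappa,\,[(p+1)/((2p+1)K)]^{1/p}\}$. Then the sequences $\{x_k\}$ and $\{t_k\}$, with starting points $x_0\in B(x_*,r)\setminus\{x_*\}$ and $t_0=\|x_0-x_*\|$, respectively, such that $$x_{k+1}=x_k-F'(x_k)^{\dagger}F(x_k),\qquad t_{k+1}=\frac{K\,p\,t_k^{p+1}}{(p+1)[1-K\,t_k^p]},\qquad k=0,1,\ldots,$$ are well defined; $\{t_k\}$ is strictly decreasing, contained in $(0,r)$ and converges to $0$. Furthermore, $\{x_k\}$ is contained in $B(x_*,r)$, it converges to the point $x_*$, which is the unique zero of $F$ in $B\big(x_*,[(p+1)/K]^{1/p}\big)$, and there hold $$\|x_{k+1}-x_*\|\le\frac{K\,p}{(p+1)[1-K\,t_k^p]}\|x_k-x_*\|^{p+1}\le\frac{K\,p}{(p+1)[1-K\|x_0-x_*\|^p]}\|x_k-x_*\|^{p+1},\qquad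 k=0,1,\ldots,$$ and $$\|x_k-x_*\|\le\left[\frac{K\,p\,\|x_0-x_*\|^p}{(p+1)[1-K\|x_0-x_*\|^p]}\right]^{[(p+1)^k-1]/p}\|x_0-x_*\|,\qquad k=0,1,\ldots.$$ Moreover, if $[(p+1)/((2p+1)K)]^{1/p}<\kappa$, then $r=[(p+1)/((2p+1)K)]^{1/p}$ is the best possible convergence radius.
   Context: $B(a,\delta)=\{x\in\mathbb X:\|x-a\|<\delta\}$ denotes the open ball. For a continuous injective linear operator $A:\mathbb X\to\mathbb Y$ with closed image, the Moore-Penrose inverse is $A^{\dagger}:=(A^*A)^{-1}A^*$, where $A^*$ is the adjoint of $A$. The iteration defining $\{x_k\}$ is the Gauss-Newton method for solving $F(x)=0$.
   Formalization: Uniqueness of the zero is stated only in B(x_*,[(p+1)/K]^{1/p}) ∩ B(x_*,κ), since beyond κ the hypotheses do not constrain F and the claim can fail; ''best possible radius'' means best for given K, p, κ, with optimality over real Hilbert spaces. *)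

(* Defs.v *)
From HB Require Import structures.
From mathcomp Require Import all_boot all_order all_algebra.
From mathcomp Require Import complex.
From mathcomp Require Import sesquilinear.
From mathcomp Require Import boolp classical_sets functions reals topology.
From mathcomp Require Import normedtype sequences derive exp.

Set Implicit Arguments.
Unset Strict Implicit.
Unset Printing Implicit Defensive.

Import Order.TTheory GRing.Theory Num.Theory.
Import numFieldNormedType.Exports.

Local Open Scope classical_set_scope.
Local Open Scope ring_scope.

Variant scalar_kind := RealScalars | ComplexScalars.

Definition scalar_field (R : realType) (c : scalar_kind) : numFieldType :=
  match c with RealScalars => R | ComplexScalars => R[i] end.

Definition sconj (R : realType) (c : scalar_kind) : scalar_field R c -> scalar_field R c :=
  match c with RealScalars => fun z => z | ComplexScalars => @conjc R end.

Fact sconj_is_zmod_morphism (R : realType) (c : scalar_kind) :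
  zmod_morphism (@sconj R c).
Proof. by case: c => // x y; exact: rmorphB. Qed.

Fact sconj_is_monoid_morphism (R : realType) (c : scalar_kind) :
  monoid_morphism (@sconj R c).
Proof. by case: c; split=> [|x y] //; [exact: rmorph1 | exact: rmorphM]. Qed.

HB.instance Definition _ (R : realType) (c : scalar_kind) :=
  GRing.isZmodMorphism.Build (scalar_field R c) (scalar_field R c) (@sconj R c)
    (@sconj_is_zmod_morphism R c).

HB.instance Definition _ (R : realType) (c : scalar_kind) :=
  GRing.isMonoidMorphism.Build (scalar_field R c) (scalar_field R c) (@sconj R c)
    (@sconj_is_monoid_morphism R c).

Definition sRe (R : realType) (c : scalar_kind) : scalar_field R c -> R :=
  match c with RealScalars => fun z => z | ComplexScalars => @complex.Re R end.

Definition of_real (R : realType) (c : scalar_kind) : R -> scalar_field R c :=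
  match c with RealScalars => fun a => a | ComplexScalars => fun a => Complex a 0 end.
Arguments of_real {R} c.

(* The inner product is linear in its first argument and conjugate-linear in
   its second one. *)
Record hilbert (R : realType) (c : scalar_kind) := Hilbert {
  hilbert_space :> completeNormedModType (scalar_field R c);
  inner : {dot hilbert_space for @sconj R c};
  inner_norm : forall x : hilbert_space, `|x| ^+ 2 = inner x x
}.

(* The library norm of a complex space takes its values in [R[i]]; [hnorm] is
   the same number seen in [R]. *)
Definition hnorm (R : realType) (c : scalar_kind) (X : hilbert R c) (x : X) : R :=
  sRe `|x|.

Definition hball (R : realType) (c : scalar_kind) (X : hilbert R c)
    (a : X) (delta : R) : set X :=
  [set x | hnorm (x - a) < delta].

(* [sup] of an unbounded set is 0: meaningful for continuous linear maps only. *)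
Definition opnorm (R : realType) (c : scalar_kind) (X Y : hilbert R c)
    (A : X -> Y) : R :=
  sup [set hnorm (A x) | x in [set x : X | hnorm x <= 1]].

Definition adjoint (R : realType) (c : scalar_kind) (X Y : hilbert R c)
    (A : X -> Y) : Y -> X :=
  xget (fun=> 0) [set B : Y -> X | forall x y, inner Y (A x) y = inner X x (B y)].

Definition moore_penrose (R : realType) (c : scalar_kind) (X Y : hilbert R c)
    (A : X -> Y) : Y -> X :=
  'pinv_(fun=> 0) [set: X] (adjoint A \o A) \o adjoint A.

Definition moore_penrose_defined (R : realType) (c : scalar_kind)
    (X Y : hilbert R c) (A : X -> Y) : Prop :=
  [/\ continuous A, injective A & closed (range A)].

Definition kappa_of (R : realType) (c : scalar_kind) (X : hilbert R c)
    (Omega : set X) (xs : X) (rad : R) : R :=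
  sup [set t : R | 0 <= t < rad /\ hball xs t `<=` Omega].

(* [F] is a total function, but only its values on the open set [Omega] are
   constrained. *)
Record holder_problem (R : realType) (c : scalar_kind) (X Y : hilbert R c)
    (Omega : set X) (F : X -> Y) (xs : X) (rad K p : R) : Prop := HolderProblem {
  hp_open : open Omega;
  hp_diff : forall x, Omega x -> differentiable F x;
  hp_C1 : forall x, Omega x -> opnorm ('d F y \- 'd F x) @[y --> x] --> (0 : R);
  hp_closed : forall x, Omega x -> closed (range ('d F x));
  hp_xs : Omega xs;
  hp_rad : 0 < rad;
  hp_zero : F xs = 0;
  hp_inj : injective ('d F xs);
  hp_K : 0 < K;
  hp_p : 0 < p <= 1;
  hp_holder : forall (x : X) (tau : R),
    hball xs (kappa_of Omega xs rad) x -> 0 <= tau <= 1 ->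
    opnorm (moore_penrose ('d F xs))
      * opnorm ('d F x \- 'd F (xs + of_real c tau *: (x - xs)))
    <= K * (1 - tau `^ p) * hnorm (x - xs) `^ p
}.

Definition gauss_newton (R : realType) (c : scalar_kind) (X Y : hilbert R c)
    (F : X -> Y) (x0 : X) (k : nat) : X :=
  iter k (fun x => x - moore_penrose ('d F x) (F x)) x0.

Definition gauss_newton_defined (R : realType) (c : scalar_kind)
    (X Y : hilbert R c) (Omega : set X) (F : X -> Y) (x0 : X) : Prop :=
  forall k, Omega (gauss_newton F x0 k) /\
            moore_penrose_defined ('d F (gauss_newton F x0 k)).

Definition majorant_seq (R : realType) (K p t0 : R) (k : nat) : R :=
  iter k (fun t => K * p * t `^ (p + 1) / ((p + 1) * (1 - K * t `^ p))) t0.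

Definition convergence_radius (R : realType) (c : scalar_kind)
    (K p kappa rho : R) : Prop :=
  forall (X Y : hilbert R c) (Omega : set X) (F : X -> Y) (xs : X) (rad : R),
    holder_problem Omega F xs rad K p -> kappa_of Omega xs rad = kappa ->
    forall x0 : X, hball xs rho x0 -> x0 <> xs ->
      gauss_newton_defined Omega F x0 /\
      gauss_newton F x0 k @[k --> \oo] --> xs.

(* [r] is a convergence radius for every problem with the data [K], [p],
   [kappa], and no larger number is one.  Optimality is required within the
   real problems: a complex-differentiable map is analytic, and the problems
   that attain the bound need not be. *)
Definition best_convergence_radius (R : realType) (K p kappa r : R) : Prop :=
  (forall c, convergence_radius c K p kappa r) /\
  (forall rho, convergence_radius RealScalars K p kappa rho -> rho <= r).

(* Main.v *)
From HB Require Import structures.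
Require Import Defs.
From mathcomp Require Import all_boot all_order all_algebra.
From mathcomp Require Import complex sesquilinear.
From mathcomp Require Import boolp classical_sets functions reals topology.
From mathcomp Require Import normedtype landau sequences derive exp.
From mathcomp Require Import ring lra.

Set Implicit Arguments.
Unset Strict Implicit.
Unset Printing Implicit Defensive.
Import Order.TTheory GRing.Theory Num.Theory.
Import numFieldNormedType.Exports.

Local Open Scope classical_set_scope.
Local Open Scope ring_scope.

(** Why the theorem holds.

    Write A for the derivative of F at the solution xs, beta for the norm of
    its Moore-Penrose inverse and e for the distance from x to xs.  The
    Moore-Penrose inverse of an injective operator B with closed image
    satisfies two identities that carry everything: it undoes B, and B applied
    to it is the orthogonal projection onto the image of B
    ([moore_penroseK], [hnorm_range_projection]).  The first one gives
    |h| <= beta |A h|; combined with the radial Hölder condition at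
    tau = 0 it yields, for every x in the ball,
      (1 - K e^p) |h| <= beta |F'(x) h|            ([derivative_below]),
    so F'(x) is again injective as long as K e^p < 1, and its Moore-Penrose
    inverse is bounded by beta / (1 - K e^p).

    Since F(xs) = 0, the error after one step is the Moore-Penrose inverse of
    F'(x) applied to F'(x)(x - xs) - (F(x) - F(xs)).  Along the segment from
    xs to x the derivative of this difference is at most
    K (1 - tau^p) e^(p+1) / beta; integrating over tau gives the factor
    p / (p + 1) and hence
      |x_+ - xs| <= K p e^(p+1) / ((p + 1) (1 - K e^p))    ([newton_step]).
    The right-hand side is the recursion of the majorant t_k and increases
    with e, so e_k <= t_k by induction.  A majorant step multiplies t by at
    most q = K p t_0^p / ((p + 1) (1 - K t_0^p)), and q < 1 says exactly that
    t_0 is below [(p + 1) / ((2 p + 1) K)]^(1/p); the remaining estimates are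
    consequences ([majorant_decr], [majorant_cvg], [error_superlinear]).

    For uniqueness, a zero x of F satisfies A h = A h - (F(x) - F(xs)) with
    h = x - xs, and the same mean value argument with A in place of F'(x)
    gives |h| <= K |h|^(p+1) / (p + 1) ([zero_unique]).

    The radius is optimal because the function x - K x |x|^p / (p + 1) of one
    real variable satisfies the Hölder condition with equality, and Newton's
    method started at the radius rho jumps between rho and -rho
    ([newton_reflects]).

    Two facts of functional analysis are established on the way: operators
    between Hilbert spaces have adjoints (projection onto closed subspaces and
    the Riesz representation), and an injective operator with closed image is
    bounded below.  The latter makes beta an actual bound rather than the
    supremum of an unbounded set.  Real and complex scalars are treated
    together by working with the real part [rin] of the inner product. *)

(** * The scalar field and its real part *)

Section Scalars.
Variables (R : realType) (c : scalar_kind).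
Implicit Types (a b : R) (z w : scalar_field R c).

Lemma sReD z w : sRe (z + w) = sRe z + sRe w.
Proof. by case: c z w => //= -[? ?] [? ?]. Qed.

Lemma sReN z : sRe (- z) = - sRe z.
Proof. by case: c z => //= -[? ?]. Qed.

Lemma sRe_of_real a : sRe (of_real c a) = a.
Proof. by case: c. Qed.

Lemma sRe_of_realM a z : sRe (of_real c a * z) = a * sRe z.
Proof. by case: c z => //= -[x y] /=; rewrite mul0r subr0. Qed.

Lemma sRe_conj z : sRe (sconj z) = sRe z.
Proof. by case: c z => //= -[x y]. Qed.

Lemma sconjK z : sconj (sconj z) = z.
Proof. by case: c z => //= -[x y]; rewrite /= opprK. Qed.

Lemma of_realD a b : of_real c (a + b) = of_real c a + of_real c b.
Proof. by case: c => //=; apply/eqP; rewrite eq_complex /= addr0 !eqxx. Qed.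

Lemma of_realM a b : of_real c (a * b) = of_real c a * of_real c b.
Proof.
by case: c => //=; apply/eqP; rewrite eq_complex /= !mulr0 mul0r subr0 addr0 !eqxx.
Qed.

Lemma norm_of_real a : `|of_real c a| = of_real c `|a|.
Proof. by case: c => //=; rewrite normc_def /= expr0n /= addr0 sqrtr_sqr. Qed.

Lemma of_real0 : of_real c 0 = 0 :> scalar_field R c.
Proof. by case: c. Qed.

Lemma of_real1 : of_real c 1 = 1 :> scalar_field R c.
Proof. by case: c. Qed.

Lemma sRe_ge0_id z : 0 <= z -> of_real c (sRe z) = z.
Proof.
case: c z => //= -[x y] /=; rewrite lecE /= => /andP[/eqP -> _] //.
Qed.

Lemma sRe_norm_eq0 z : sRe `|z| = 0 -> z = 0.
Proof.
by move=> h; apply/eqP; rewrite -normr_eq0 -(sRe_ge0_id (normr_ge0 z)) h of_real0.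
Qed.

Lemma sRe_le z w : z <= w -> sRe z <= sRe w.
Proof. by case: c z w => //= z w; rewrite lecE => /andP[]. Qed.

Lemma of_real_lt a b : (of_real c a < of_real c b) = (a < b).
Proof. by case: c => //=; rewrite ltcE /= eqxx. Qed.

Lemma of_real_gt0 a : (0 < of_real c a) = (0 < a).
Proof. by rewrite -of_real0 of_real_lt. Qed.

Lemma sRe_conjM z : sRe (sconj z * z) = sRe `|z| ^+ 2.
Proof.
case: c z => [x|[x y]] /=; first by rewrite real_normK ?num_real // expr2.
rewrite sqr_sqrtr ?addr_ge0 ?sqr_ge0 //; ring.
Qed.

Lemma sRe_conjM_eq0 z : sRe (sconj z * z) = 0 -> z = 0.
Proof. by rewrite sRe_conjM => /eqP; rewrite sqrf_eq0 => /eqP /sRe_norm_eq0. Qed.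

Lemma sRe_norm_conj z : sRe `|sconj z| = sRe `|z|.
Proof. by case: c z => //= -[x y] /=; rewrite sqrrN. Qed.

End Scalars.

(** * Real geometry of a Hilbert space *)

Definition rin (R : realType) (c : scalar_kind) (X : hilbert R c) (x y : X) : R :=
  sRe (inner X x y).

Lemma inv_nat_small (R : realType) (e : R) : 0 < e ->
  exists N, forall n, (N <= n)%N -> n.+1%:R^-1 < e.
Proof.
move=> e0; exists (Num.truncn e^-1) => n Nn.
rewrite -[e]invrK ltf_pV2 ?posrE ?invr_gt0 ?ltr0Sn //.
by rewrite -truncn_lt_nat ?invr_ge0 ?(ltW e0).
Qed.

Section RealInner.
Variables (R : realType) (c : scalar_kind) (X : hilbert R c).
Implicit Types (x y z u v : X) (a b : R).

Lemma innerC x y : inner X x y = sconj (inner X y x).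
Proof. by rewrite (hermC (inner X)) /= expr0 mul1r. Qed.

Lemma rinC x y : rin x y = rin y x.
Proof. by rewrite /rin innerC sRe_conj. Qed.

Lemma rinDl x y z : rin (x + y) z = rin x z + rin y z.
Proof. by rewrite /rin linearDl sReD. Qed.

Lemma rinNl x z : rin (- x) z = - rin x z.
Proof. by rewrite /rin linearNl sReN. Qed.

Lemma rinBl x y z : rin (x - y) z = rin x z - rin y z.
Proof. by rewrite rinDl rinNl. Qed.

Lemma rinZl a x z : rin (of_real c a *: x) z = a * rin x z.
Proof. by rewrite /rin linearZl_LR /= sRe_of_realM. Qed.

Lemma rinDr x y z : rin z (x + y) = rin z x + rin z y.
Proof. by rewrite rinC rinDl !(rinC z). Qed.

Lemma rinNr x z : rin z (- x) = - rin z x.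
Proof. by rewrite rinC rinNl (rinC z). Qed.

Lemma rinBr x y z : rin z (x - y) = rin z x - rin z y.
Proof. by rewrite rinDr rinNr. Qed.

Lemma rinZr a x z : rin z (of_real c a *: x) = a * rin z x.
Proof. by rewrite rinC rinZl (rinC z). Qed.

Lemma rin0l z : rin 0 z = 0.
Proof. by rewrite -(subrr (0 : X)) rinBl subrr. Qed.

Lemma hnorm_of_real x : of_real c (hnorm x) = `|x|.
Proof. exact: sRe_ge0_id. Qed.

Lemma rinxx x : rin x x = hnorm x ^+ 2.
Proof.
by rewrite /rin -inner_norm -hnorm_of_real expr2 -of_realM sRe_of_real expr2.
Qed.

Lemma hnorm_ge0 x : 0 <= hnorm x.
Proof. by rewrite -(sRe_of_real c 0) of_real0; apply: sRe_le. Qed.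

Lemma hnorm0 : hnorm (0 : X) = 0.
Proof. by rewrite /hnorm normr0 -of_real0 sRe_of_real. Qed.

Lemma hnorm0_eq0 x : hnorm x = 0 -> x = 0.
Proof.
by move=> h; apply/eqP; rewrite -normr_eq0 -hnorm_of_real h of_real0 eqxx.
Qed.

Lemma hnorm_gt0 x : x <> 0 -> 0 < hnorm x.
Proof.
move=> x0; rewrite lt_neqAle hnorm_ge0 andbT eq_sym; apply/eqP => /hnorm0_eq0.
by [].
Qed.

Lemma hnormN x : hnorm (- x) = hnorm x.
Proof. by rewrite /hnorm normrN. Qed.

Lemma hnormBC x y : hnorm (x - y) = hnorm (y - x).
Proof. by rewrite -hnormN opprB. Qed.

Lemma hnormD x y : hnorm (x + y) <= hnorm x + hnorm y.
Proof. by rewrite /hnorm -sReD; apply: sRe_le; exact: ler_normD. Qed.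

Lemma hnormB x y : hnorm (x - y) <= hnorm x + hnorm y.
Proof. by rewrite -(hnormN y); exact: hnormD. Qed.

Lemma hnorm_triangle y x z : hnorm (x - z) <= hnorm (x - y) + hnorm (y - z).
Proof.
have -> : x - z = (x - y) + (y - z) by rewrite addrA addrNK.
exact: hnormD.
Qed.

Lemma hnormZ a x : hnorm (of_real c a *: x) = `|a| * hnorm x.
Proof.
rewrite /hnorm normrZ norm_of_real sRe_of_realM //.
Qed.

Lemma hnormZ_ge0 a x : 0 <= a -> hnorm (of_real c a *: x) = a * hnorm x.
Proof. by move=> a0; rewrite hnormZ ger0_norm. Qed.

(** Cauchy-Schwarz is the triangle inequality squared: the norm is part of the
    structure, so its triangle inequality is available first. *)
Lemma rin_le x y : rin x y <= hnorm x * hnorm y.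
Proof.
have : hnorm (x + y) ^+ 2 <= (hnorm x + hnorm y) ^+ 2.
  by rewrite lerXn2r ?nnegrE ?addr_ge0 ?hnorm_ge0 // hnormD.
rewrite -rinxx rinDl !rinDr !rinxx (rinC y x); lra.
Qed.

Lemma rin_abs_le x y : `|rin x y| <= hnorm x * hnorm y.
Proof.
rewrite ler_norml rin_le andbT lerNl -rinNl -(hnormN x); exact: rin_le.
Qed.

(** Rotating [x] by the conjugate of the inner product makes that inner product
    real and nonnegative, which reduces the claim to its real part. *)
Lemma inner_abs_le x y : sRe `|inner X x y| <= hnorm x * hnorm y.
Proof.
set z := inner X x y.
have z0 : 0 <= sRe `|z| by rewrite -(sRe_of_real c 0) of_real0 sRe_le.
have : sRe `|z| ^+ 2 <= sRe `|z| * (hnorm x * hnorm y).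
  have := rin_le (sconj z *: x) y.
  rewrite /rin linearZl_LR /= -/z sRe_conjM /hnorm normrZ.
  rewrite -(sRe_ge0_id (normr_ge0 (sconj z))) sRe_of_realM sRe_norm_conj mulrA //.
have := mulr_ge0 (hnorm_ge0 x) (hnorm_ge0 y); nra.
Qed.

Lemma inner_eq0 u v : (forall a : scalar_field R c, rin u (a *: v) = 0) ->
  inner X u v = 0.
Proof.
move=> /(_ (inner X u v)); rewrite /rin linearZr_LR /=; exact: sRe_conjM_eq0.
Qed.

(* closedness and limits phrased with the real-valued norm *)

(** Neighbourhoods in a complex space are given by radii in [R[i]].  This
    lemma and the three that follow restate topological notions with radii
    in [R], so that all later estimates are inequalities between reals. *)
Lemma nbhs_hnorm (P : set X) x :
  nbhs x P <-> exists2 e : R, 0 < e & forall y, hnorm (y - x) < e -> P y.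
Proof.
split=> [/nbhs_normP[e /= e0 eP]|[e e0 eP]].
  exists (sRe e); first by rewrite -(of_real_gt0 c) sRe_ge0_id ?ltW.
  move=> y ye; apply: eP => /=.
  by rewrite -hnorm_of_real -(sRe_ge0_id (ltW e0)) of_real_lt hnormBC.
apply/nbhs_normP; exists (of_real c e); first by rewrite /= of_real_gt0.
by move=> y /=; rewrite -hnorm_of_real of_real_lt hnormBC; exact: eP.
Qed.

Lemma hcvgP (u : nat -> X) l : u @ \oo --> l <->
  forall e : R, 0 < e -> exists N, forall n, (N <= n)%N -> hnorm (u n - l) < e.
Proof.
split=> [ul e e0|ul].
  have /ul : nbhs l [set y | hnorm (y - l) < e] by apply/nbhs_hnorm; exists e.
  by move=> [N _ NP]; exists N => n /NP.
move=> P /nbhs_hnorm[e e0 eP]; have [N NP] := ul _ e0.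
by exists N => // n /= /NP; exact: eP.
Qed.

Lemma hcauchy_cvg (u : nat -> X) :
  (forall e : R, 0 < e -> exists N, forall m n, (N <= m)%N -> (N <= n)%N ->
     hnorm (u m - u n) < e) ->
  exists l, forall e : R, 0 < e ->
    exists N, forall n, (N <= n)%N -> hnorm (u n - l) < e.
Proof.
move=> uC.
suff /cauchy_cvgP cu : cauchy (u @ \oo).
  by exists (lim (u @ \oo)); apply/hcvgP.
apply/cauchy_ballP => e e0; rewrite near_simpl.
have e0' : 0 < sRe e by rewrite -(of_real_gt0 c) sRe_ge0_id ?ltW.
have [N NP] := uC _ e0'.
exists ([set n | (N <= n)%N], [set n | (N <= n)%N]) => /=.
  by split; exists N.
move=> [m n] [/= Nm Nn]; rewrite -ball_normE /=.
by rewrite -hnorm_of_real -(sRe_ge0_id (ltW e0)) of_real_lt; exact: NP.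
Qed.

Lemma closed_hnorm (M : set X) : closed M ->
  forall x, (forall e : R, 0 < e -> exists2 m, M m & hnorm (x - m) < e) -> M x.
Proof.
move=> cM x xM; apply: cM => B /nbhs_hnorm[e e0 eB].
by have [m Mm xm] := xM _ e0; exists m; split=> //; apply: eB; rewrite hnormBC.
Qed.

End RealInner.

(** * Orthogonal projection and the Riesz representation *)

Section Projection.
Variables (R : realType) (c : scalar_kind) (X : hilbert R c).
Implicit Types (x y z : X) (M : set X).

(** Closedness is in approximation form, which is easy to check both for a
    topologically closed image and for a closure that is defined by
    approximation. *)
Record closed_subspace M : Prop := ClosedSubspace {
  csub0 : M 0;
  csubD : forall x y, M x -> M y -> M (x + y);
  csubZ : forall (a : scalar_field R c) x, M x -> M (a *: x);
  csub_lim : forall x,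
    (forall e : R, 0 < e -> exists2 m, M m & hnorm (x - m) < e) -> M x }.

Lemma parallelogram x y :
  hnorm (x - y) ^+ 2 = 2 * hnorm x ^+ 2 + 2 * hnorm y ^+ 2 - hnorm (x + y) ^+ 2.
Proof. by rewrite -!rinxx !(rinDl, rinDr, rinNl, rinNr) (rinC y x); ring. Qed.

(** The quadratic polynomial a |-> |u - a z|^2 - |u|^2 is nonnegative and
    vanishes at 0, so its linear coefficient vanishes.  The proof evaluates it
    at a = (u,z) / (|z|^2 + 1), a denominator that is never zero. *)
Lemma minimizer_orthogonal u z :
  (forall a : R, hnorm u <= hnorm (u - of_real c a *: z)) -> rin u z = 0.
Proof.
move=> umin.
have q a : 0 <= a ^+ 2 * rin z z - 2 * a * rin u z.
  have : hnorm u ^+ 2 <= hnorm (u - of_real c a *: z) ^+ 2.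
    by rewrite lerXn2r ?nnegrE ?hnorm_ge0.
  rewrite -!rinxx !(rinBl, rinBr) !(rinZl, rinZr) (rinC z u); nra.
have zz : 0 <= rin z z by rewrite rinxx sqr_ge0.
have := q (rin u z / (rin z z + 1)); set s := rin u z.
set t := s / _; have st : s = t * (rin z z + 1).
  by rewrite /t divfK // gt_eqF //; lra.
rewrite st => h.
have : t ^+ 2 * (rin z z + 2) <= 0 by nra.
rewrite pmulr_lle0; last by lra.
by move=> t2; have /eqP := le_anti (introT andP (conj t2 (sqr_ge0 t)));
  rewrite sqrf_eq0 => /eqP ->; rewrite mul0r.
Qed.

(** A sequence of points of [M] whose distance to [y] approaches the infimum is
    Cauchy by the parallelogram identity, the midpoints being in [M] as well;
    its limit realises the infimum. *)
Lemma projection M : closed_subspace M ->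
  forall y, exists2 m, M m & forall z, M z -> inner X (y - m) z = 0.
Proof.
move=> [M0 MD MZ Mlim] y.
pose D := [set hnorm (y - m) | m in M].
have lD : has_inf D.
  split; first by exists (hnorm (y - 0)), 0.
  by exists 0 => _ [m _ <-]; exact: hnorm_ge0.
pose d := inf D.
have dle m : M m -> d <= hnorm (y - m).
  by move=> Mm; apply: ge_inf; [case: lD | exists m].
have d0 : 0 <= d.
  apply: lb_le_inf; first by case: lD.
  by move=> _ [m _ <-]; exact: hnorm_ge0.
have /choice[u uP] n : exists m, M m /\ hnorm (y - m) < d + n.+1%:R^-1.
  have n0 : 0 < n.+1%:R^-1 :> R by rewrite invr_gt0 ltr0Sn.
  have [_ [m Mm <-] md] := inf_adherent n0 lD.
  by exists m.
have half m m' : M m -> M m' ->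
  4 * d ^+ 2 <= hnorm (y - m + (y - m')) ^+ 2.
  move=> Mm Mm'.
  have -> : y - m + (y - m') = of_real c 2 *: (y - of_real c 2^-1 *: (m + m')).
    rewrite scalerBr scalerA -of_realM divff ?pnatr_eq0 // of_real1 scale1r.
    have -> : of_real c (2 : R) = 2 :> scalar_field R c.
      by rewrite [2]/(1 + 1) of_realD of_real1.
    by rewrite scaler_nat mulr2n opprD addrACA.
  rewrite hnormZ_ge0 // exprMn.
  have := dle (of_real c 2^-1 *: (m + m')) (MZ _ _ (MD _ _ Mm Mm')).
  by move=> h; nra.
have [m mP] : exists l, forall e : R, 0 < e ->
    exists N, forall n, (N <= n)%N -> hnorm (u n - l) < e.
  apply: hcauchy_cvg => e e0.
  (* eta is chosen so that 8 d eta + 4 eta^2 <= (8 d + 4) eta < e^2 *)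
  pose eta := Num.min 1 (e ^+ 2 / (8 * d + 5)).
  have d5 : 0 < 8 * d + 5 by lra.
  have eta0 : 0 < eta by rewrite lt_min ltr01 /= divr_gt0 ?exprn_gt0.
  have eta1 : eta <= 1 by rewrite ge_min lexx.
  have etae : eta * (8 * d + 5) <= e ^+ 2 by rewrite -ler_pdivlMr // ge_min lexx orbT.
  have [N NP] := inv_nat_small eta0; exists N => i j Ni Nj.
  have [[Mi yi] [Mj yj]] := (uP i, uP j).
  have := NP _ Ni; have := NP _ Nj; have := half _ _ Mi Mj.
  have hij : hnorm (u i - u j) ^+ 2 = 2 * hnorm (y - u i) ^+ 2 +
      2 * hnorm (y - u j) ^+ 2 - hnorm (y - u i + (y - u j)) ^+ 2.
    rewrite -parallelogram hnormBC; congr (hnorm _ ^+ 2).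
    by rewrite opprB [RHS]addrC addrA subrK.
  move=> h4 ej ei.
  have sq v (eps : R) : 0 <= v -> v < d + eps -> eps < eta -> v ^+ 2 <= (d + eta) ^+ 2.
    by move=> v0 vd ve; rewrite lerXn2r ?nnegrE //; lra.
  have si := sq _ _ (hnorm_ge0 _) yi ei.
  have sj := sq _ _ (hnorm_ge0 _) yj ej.
  rewrite -(@ltr_pXn2r _ 2) ?nnegrE ?hnorm_ge0 ?(ltW e0) // hij.
  nra.
have Mm : M m.
  apply: Mlim => e /mP[N /(_ N (leqnn N)) h]; exists (u N); first by case: (uP N).
  by rewrite hnormBC.
have ym : hnorm (y - m) <= d.
  apply/ler_addgt0Pr => e e0.
  have e2 : 0 < e / 2 by rewrite divr_gt0.
  have [[N NP] [N' NP']] := (mP _ e2, inv_nat_small e2).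
  have [_ h] := uP (maxn N N').
  have h1 := NP _ (leq_maxl N N'); have h2 := NP' _ (leq_maxr N N').
  have := hnorm_triangle (u (maxn N N')) y m.
  by move: h h1 h2; set v := _^-1 => h h1 h2; lra.
exists m => // z Mz; apply: inner_eq0 => a.
apply: minimizer_orthogonal => b; rewrite -addrA -opprD.
by apply: (le_trans ym); apply: dle; apply: MD => //; exact/MZ/MZ.
Qed.

(** The representing vector is a multiple of a vector orthogonal to the kernel. *)
Lemma riesz (phi : X -> scalar_field R c) (C : R) : 0 <= C ->
  (forall a x y, phi (a *: x + y) = a * phi x + phi y) ->
  (forall x, sRe `|phi x| <= C * hnorm x) ->
  exists u, forall x, phi x = inner X x u.
Proof.
move=> C0 lin bnd.
have phiD x y : phi (x + y) = phi x + phi y.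
  by have := lin 1 x y; rewrite scale1r mul1r.
have phi0 : phi 0 = 0.
  have /eqP := phiD 0 0; rewrite addr0 -subr_eq0 opprD addrA subrr sub0r.
  by rewrite oppr_eq0 => /eqP.
have phiZ a x : phi (a *: x) = a * phi x by have := lin a x 0; rewrite phi0 !addr0.
have phiB x y : phi (x - y) = phi x - phi y by rewrite -scaleN1r phiD phiZ mulN1r.
have [all0|/existsNP[x0 px0]] := pselect (forall x, phi x = 0).
  by exists 0 => x; rewrite all0 linear0r.
have ker : closed_subspace [set x | phi x = 0].
  split=> //= [x y px py|a x px|x lim].
  - by rewrite phiD px py addr0.
  - by rewrite phiZ px mulr0.
  apply: sRe_norm_eq0; apply/le_anti/andP; split; last first.
    by rewrite -(sRe_of_real c 0) of_real0 sRe_le.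
  apply/ler_addgt0Pr => e e0; rewrite add0r.
  have [|m pm xm] := lim (e / (C + 1)); first by rewrite divr_gt0 // ltr_wpDl.
  rewrite -[phi x]subr0 -[in phi x - 0]pm -phiB.
  apply: (le_trans (bnd _)).
  have /ltW := xm; rewrite ler_pdivlMr; last by rewrite ltr_wpDl.
  by have := hnorm_ge0 (x - m); nra.
have [m pm mP] := projection ker x0.
set n := x0 - m in mP.
have pn : phi n = phi x0 by rewrite phiB pm subr0.
have n0 : phi n != 0 by rewrite pn; exact/eqP.
have nn0 : inner X n n != 0.
  rewrite -inner_norm expf_eq0 normr_eq0 /=.
  by apply: contra n0 => /eqP ->; rewrite phi0.
exists (sconj (phi n / inner X n n) *: n) => x.
have : inner X n (x - (phi x / phi n) *: n) = 0.
  by apply: mP; rewrite /= phiB phiZ divfK // subrr.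
rewrite linearBr linearZr_LR /= => /eqP; rewrite subr_eq0 => /eqP nx.
rewrite linearZr_LR /= sconjK (innerC x n) nx rmorphM /= sconjK -innerC.
by rewrite mulrACA mulVf // mulr1 mulrC divfK.
Qed.
End Projection.

(** * Adjoints and operators bounded below *)

Section GlidingHump.
Variables (R : realType) (c : scalar_kind) (Y : hilbert R c).

(** The core of the uniform boundedness principle, by a gliding hump instead of
    Baire's theorem: y is the sum of the vectors +-3^-n w_n, the sign being
    chosen so that the n-th term does not decrease the absolute value of the
    inner product with w_n.  That value is then at least 3^-n after n + 1
    terms, and the later terms take away at most 3^-n / 2. *)
Lemma gliding_hump (M : set Y) (w : nat -> Y) : closed_subspace M ->
  (forall n, M (w n)) -> (forall n, hnorm (w n) = 1) ->
  exists2 y, M y & forall n, 3^-1 ^+ n / 2 <= `|rin y (w n)|.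
Proof.
move=> sM Mw w1.
pose q : R := 3^-1.
have q0 n : 0 < q ^+ n by rewrite exprn_gt0 // invr_gt0.
pose sg (x : R) : R := if 0 <= x then 1 else -1.
have sg1 x : `|sg x| = 1 by rewrite /sg; case: ifP; rewrite ?normrN normr1.
pose fix s n := if n is m.+1
  then s m + of_real c (sg (rin (s m) (w m)) * q ^+ m) *: w m else 0.
have Ms n : M (s n).
  elim: n => [|n IH] /=; first exact: csub0 sM.
  by apply: (csubD sM) => //; exact: (csubZ sM).
have key n : q ^+ n <= `|rin (s n.+1) (w n)|.
  rewrite /= rinDl rinZl rinxx w1 expr1n mulr1.
  rewrite /sg; case: ifP => [r0|/negbT]; last rewrite -ltNge => r0.
    by apply: le_trans (ler_norm _); rewrite mul1r lerDr.
  by rewrite -normrN; apply: le_trans (ler_norm _); rewrite mulN1r; lra.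
have step n k : hnorm (s (n + k)%N - s n) <= 3 / 2 * (q ^+ n - q ^+ (n + k)).
  elim: k => [|k IH]; first by rewrite addn0 !subrr hnorm0 mulr0.
  rewrite addnS exprS; apply: (le_trans (hnorm_triangle (s (n + k)%N) _ _)).
  rewrite [s (n + k).+1]/= addrAC subrr add0r hnormZ w1 mulr1 normrM sg1 mul1r.
  rewrite ger0_norm ?(ltW (q0 _)) //.
  have -> : q * q ^+ (n + k) = q ^+ (n + k) / 3 by rewrite mulrC.
  lra.
have tail N n : (N <= n)%N -> hnorm (s n - s N) <= 3 / 2 * q ^+ N.
  move=> Nn; rewrite -(subnKC Nn); apply: (le_trans (step _ _)).
  by have := q0 (N + (n - N))%N; lra.
have small (e : R) : 0 < e -> exists N, q ^+ N < e.
  move=> /inv_nat_small[N /(_ N (leqnn N)) h]; exists N; apply: le_lt_trans h.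
  rewrite exprVn lef_pV2 ?posrE ?exprn_gt0 ?ltr0Sn // -natrX ler_nat.
  exact: ltn_expl.
have [y yP] : exists l, forall e : R, 0 < e ->
    exists N, forall n, (N <= n)%N -> hnorm (s n - l) < e.
  apply: hcauchy_cvg => e e0.
  have [|N Ne] := small (e / 3); first by rewrite divr_gt0.
  exists N => m n Nm Nn; have h1 := tail _ _ Nm; have h2 := tail _ _ Nn.
  have := hnorm_triangle (s N) (s m) (s n); rewrite (hnormBC (s N) (s n)).
  lra.
exists y.
  apply: (csub_lim sM) => e /yP[N /(_ N (leqnn N)) h].
  by exists (s N) => //; rewrite hnormBC.
move=> n.
have ys : hnorm (s n.+1 - y) <= q ^+ n / 2.
  apply/ler_addgt0Pr => e /yP[N NP].
  have h1 := NP _ (leq_maxl N n.+1); have h2 := tail _ _ (leq_maxr N n.+1).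
  have h3 := hnorm_triangle (s (maxn N n.+1)) (s n.+1) y.
  rewrite hnormBC in h2.
  have h4 : 3 / 2 * q ^+ n.+1 = q ^+ n / 2 by rewrite exprS /q; field.
  rewrite h4 in h2; move: h1 h2 h3.
  move: (s (maxn N n.+1)) (s n.+1) => t t' h1 h2 h3.
  lra.
have := key n; have := rin_abs_le (s n.+1 - y) (w n); rewrite w1 mulr1 rinBl.
have := ler_dist_dist (rin (s n.+1) (w n)) (rin y (w n)).
rewrite ler_norml => /andP[_]; rewrite -/q; lra.
Qed.

End GlidingHump.

Section Adjoint.
Variables (R : realType) (c : scalar_kind) (X Y : hilbert R c).

Definition hbounded (A : X -> Y) :=
  exists2 C : R, 0 <= C & forall x, hnorm (A x) <= C * hnorm x.

Lemma continuous_hbounded (A : {linear X -> Y}) : continuous A -> hbounded A.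
Proof.
move=> cA.
have : nbhs (A 0) [set y | hnorm (y - 0) < 1].
  by rewrite linear0; apply/nbhs_hnorm; exists 1.
move=> /cA /nbhs_hnorm[e e0 eP].
exists (2 / e); first by rewrite divr_ge0 // ltW.
move=> x; have [->|/eqP x0] := eqVneq x 0; first by rewrite linear0 !hnorm0 mulr0.
have nx := hnorm_gt0 x0.
pose a := e / (2 * hnorm x).
have a0 : 0 < a by rewrite divr_gt0 // mulr_gt0.
have ax : a * hnorm x = e / 2 by rewrite /a; field; rewrite gt_eqF.
have := eP (of_real c a *: x).
rewrite /= !subr0 linearZ /= !hnormZ_ge0 ?(ltW a0) // ax => /(_ _)/ltW h.
have {}h : a * hnorm (A x) <= 1 by apply: h; lra.
rewrite -(ler_pM2l a0) mulrCA ax; apply: (le_trans h).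
by have -> : 2 / e * (e / 2) = 1 by field; rewrite gt_eqF.
Qed.

Variable A : {linear X -> Y}.
Hypothesis bA : hbounded A.

(** [adjoint] is defined by choice; the Riesz representation of the functionals
    x |-> (A x, y) shows that there is something to choose. *)
Lemma adjointE x y : inner Y (A x) y = inner X x (adjoint A y).
Proof.
suff : [set B : Y -> X | forall x y, inner Y (A x) y = inner X x (B y)]
         (adjoint A) by exact.
apply: xgetPex.
suff /choice[B BP] : forall y, exists u, forall x, inner Y (A x) y = inner X x u.
  by exists B => u v; exact: BP.
move=> {x y} y; have [C C0 CP] := bA.
apply: (@riesz _ _ _ _ (C * hnorm y)).
- by rewrite mulr_ge0 ?hnorm_ge0.
- by move=> a u v; rewrite linearP linearDl linearZl_LR.
- move=> u; apply: (le_trans (inner_abs_le _ _)).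
  by have := CP u; have := hnorm_ge0 y; nra.
Qed.

Lemma rin_adjoint x y : rin (A x) y = rin x (adjoint A y).
Proof. by rewrite /rin adjointE. Qed.

Lemma inner_injr (x y : X) : (forall z, inner X z x = inner X z y) -> x = y.
Proof.
move=> h; apply/eqP; rewrite -subr_eq0; apply/eqP/hnorm0_eq0/eqP.
have : rin (x - y) (x - y) = 0.
  by rewrite rinBr /rin h subrr.
by rewrite rinxx => /eqP; rewrite sqrf_eq0.
Qed.

Lemma adjoint_linear a y z : adjoint A (a *: y + z) = a *: adjoint A y + adjoint A z.
Proof.
by apply: inner_injr => x; rewrite -adjointE !linearPr /= -!adjointE.
Qed.

Lemma adjoint0 : adjoint A 0 = 0.
Proof.
by apply: inner_injr => x; rewrite -adjointE !linear0r.
Qed.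

Hypothesis clA : closed (range A).

Lemma closed_range_subspace : closed_subspace (range A).
Proof.
split.
- by exists 0 => //; rewrite linear0.
- by move=> _ _ [x _ <-] [y _ <-]; exists (x + y) => //; rewrite linearD.
- by move=> a _ [x _ <-]; exists (a *: x) => //; rewrite linearZ.
- exact: closed_hnorm.
Qed.

(** If the adjoint A' were not bounded below on the image of A, that image would
    contain unit vectors w_n with n 3^n |A' w_n| < 1.  The vector y = A x of
    [gliding_hump] then satisfies
    3^-n / 2 <= |(A x, w_n)| = |(x, A' w_n)| <= |x| / (n 3^n) for all n,
    which is impossible. *)
Lemma adjoint_below : exists2 C : R, 0 <= C &
  forall x, hnorm (A x) <= C * hnorm (adjoint A (A x)).
Proof.
apply: contrapT => noC.
have /choice[w wP] (n : nat) : exists w, [/\ range A w, hnorm w = 1 &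
    n%:R * 3 ^+ n * hnorm (adjoint A w) < 1].
  have [x xP] : exists x,
      n%:R * 3 ^+ n * hnorm (adjoint A (A x)) < hnorm (A x).
    apply: contrapT => nx; apply: noC; exists (n%:R * 3 ^+ n).
      by rewrite mulr_ge0 ?exprn_ge0.
    by move=> x; rewrite leNgt; apply/negP => h; apply: nx; exists x.
  have Ax : 0 < hnorm (A x).
    by apply: le_lt_trans xP; rewrite !mulr_ge0 ?exprn_ge0 ?hnorm_ge0.
  exists (of_real c (hnorm (A x))^-1 *: A x); split.
  - by exists (of_real c (hnorm (A x))^-1 *: x) => //; rewrite linearZ.
  - by rewrite hnormZ_ge0 ?invr_ge0 ?hnorm_ge0 // mulVf // gt_eqF.
  - have := adjoint_linear (of_real c (hnorm (A x))^-1) (A x) 0.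
    rewrite adjoint0 !addr0 => ->.
    rewrite hnormZ_ge0 ?invr_ge0 ?hnorm_ge0 // mulrCA mulrC.
    by rewrite ltr_pdivrMr // mul1r.
have [||_ [x _ <-] yP] := @gliding_hump _ _ _ _ w closed_range_subspace.
- by move=> n; have [] := wP n.
- by move=> n; have [] := wP n.
have [n xn] : exists n : nat, 2 * hnorm x < n%:R.
  exists (Num.truncn (2 * hnorm x)).+1.
  by rewrite -truncn_lt_nat ?mulr_ge0 ?hnorm_ge0.
have [_ _ wn] := wP n.
have t0 : 0 < 3 ^+ n :> R by rewrite exprn_gt0.
have := yP n; rewrite rin_adjoint exprVn => h.
have {h} := le_trans h (rin_abs_le _ _).
rewrite [X in X <= _]mulrC ler_pdivrMr // => h.
have x0 := hnorm_ge0 x.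
pose b := 3 ^+ n * hnorm (adjoint A (w n)).
have b0 : 0 <= b by rewrite mulr_ge0 ?hnorm_ge0 ?ltW.
have {}wn : n%:R * b < 1 by rewrite /b mulrA.
have {}h : 2^-1 <= hnorm x * b by rewrite /b [3 ^+ n * _]mulrC mulrA.
have := ler_wpM2r b0 (ltW xn); rewrite -mulrA; lra.
Qed.

(** The bounded inverse theorem.  Let A' be the adjoint.  Injectivity makes the
    image of A'A dense: a vector z orthogonal to it satisfies
    |A z|^2 = (z, A'A z) = 0.  If A'A u is close to x, then |x|^2 is close to
    (x, A'A u) = (A x, A u) <= C |A x| |A'A u| by [adjoint_below], and
    |A'A u| is close to |x|. *)
Lemma bounded_below : injective A ->
  exists2 C : R, 0 <= C & forall x, hnorm x <= C * hnorm (A x).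
Proof.
move=> injA; have [C C0 CP] := adjoint_below; exists C => // x.
pose AA := fun u => adjoint A (A u).
(* the closure of the image of A'A *)
pose N := [set z : X | forall e : R, 0 < e -> exists u, hnorm (z - AA u) < e].
have AAP a u v : AA (a *: u + v) = a *: AA u + AA v.
  by rewrite /AA linearP adjoint_linear.
have AA0 : AA 0 = 0 by rewrite /AA linear0 adjoint0.
have sN : closed_subspace N.
  split.
  - by move=> e e0; exists 0; rewrite AA0 subr0 hnorm0.
  - move=> y z Ny Nz e e0.
    have [|u uP] := Ny (e / 2); first by rewrite divr_gt0.
    have [|v vP] := Nz (e / 2); first by rewrite divr_gt0.
    exists (1 *: u + v); rewrite AAP scale1r opprD addrACA.
    by apply: (le_lt_trans (hnormD _ _)); lra.
  - move=> a z Nz e e0.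
    have a0 : 0 <= sRe `|a| by rewrite -(sRe_of_real c 0) of_real0 sRe_le.
    have [|u uP] := Nz (e / (sRe `|a| + 1)); first by rewrite divr_gt0 // ltr_wpDl.
    exists (a *: u + 0); rewrite AAP AA0 addr0 -scalerBr.
    rewrite /hnorm normrZ -(sRe_ge0_id (normr_ge0 a)) sRe_of_realM.
    have := uP; rewrite ltr_pdivlMr ?ltr_wpDl //.
    by have := hnorm_ge0 (z - AA u); rewrite /hnorm; nra.
  - move=> z lim e e0.
    have [|m Nm zm] := lim (e / 2); first by rewrite divr_gt0.
    have [|u uP] := Nm (e / 2); first by rewrite divr_gt0.
    exists u; have := hnorm_triangle m z (AA u); lra.
have [m Nm mP] := projection sN x.
have xm : x = m.
  apply/eqP; rewrite -subr_eq0; apply/eqP; apply: injA; rewrite linear0.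
  apply: hnorm0_eq0; apply/eqP; rewrite -sqrf_eq0 -rinxx rin_adjoint /rin mP.
    by rewrite -of_real0 sRe_of_real.
  by move=> e e0; exists (x - m); rewrite subrr hnorm0.
have [->|/eqP x0] := eqVneq x 0; first by rewrite linear0 !hnorm0 mulr0.
have nx := hnorm_gt0 x0.
have : hnorm x ^+ 2 <= C * hnorm (A x) * hnorm x.
  apply/ler_addgt0Pr => e e0.
  have Ax := hnorm_ge0 (A x).
  pose k := hnorm x + C * hnorm (A x).
  have k0 : 0 < k by rewrite ltr_wpDr // mulr_ge0.
  have := Nm; rewrite -xm => /(_ (e / k)); case=> [|u]; first by rewrite divr_gt0.
  rewrite ltr_pdivlMr // => uP.
  have h1 := rin_le x (x - AA u); have h2 := rin_le (A x) (A u).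
  have h3 := CP u; rewrite -/(AA u) in h3.
  have h4 := hnorm_triangle x (AA u) 0; rewrite !subr0 (hnormBC (AA u)) in h4.
  have : hnorm x ^+ 2 = rin x (x - AA u) + rin (A x) (A u).
    by rewrite rin_adjoint rinBr subrK rinxx.
  move=> ->.
  have h5 : hnorm (A u) <= C * (hnorm (x - AA u) + hnorm x) by nra.
  have h6 : hnorm (A x) * hnorm (A u) <=
    hnorm (A x) * (C * (hnorm (x - AA u) + hnorm x)) by nra.
  rewrite /k in uP; nra.
by rewrite expr2 ler_pM2r.
Qed.

End Adjoint.

(** * Operator norm and Moore-Penrose inverse *)

Section OperatorNorm.
Variables (R : realType) (c : scalar_kind) (X Y : hilbert R c).

Lemma opnorm_le (A : X -> Y) (C : R) : 0 <= C ->
  (forall x, hnorm (A x) <= C * hnorm x) -> opnorm A <= C.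
Proof.
move=> C0 AC; apply: ge_sup.
  by exists (hnorm (A 0)), 0 => //=; rewrite hnorm0.
by move=> _ [x /= x1 <-]; apply: le_trans (AC x) _; rewrite ler_piMr.
Qed.

(** Stated for real-homogeneous maps so that it applies to differences of
    derivatives and to [moore_penrose A], which carry no linear structure. *)
Lemma le_opnorm (A : X -> Y) : hbounded A ->
  (forall (a : R) x, A (of_real c a *: x) = of_real c a *: A x) ->
  forall x, hnorm (A x) <= opnorm A * hnorm x.
Proof.
move=> [C C0 AC] AZ x.
have [->|/eqP x0] := eqVneq x 0.
  by rewrite -{1}(scaler0 _ (of_real c 0)) AZ of_real0 scale0r !hnorm0 mulr0.
have nx := hnorm_gt0 x0.
rewrite -ler_pdivrMr // mulrC -hnormZ_ge0 ?invr_ge0 ?hnorm_ge0 // -AZ.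
apply: ub_le_sup.
  exists C => _ [z /= z1 <-]; apply: le_trans (AC z) _.
  by rewrite ler_piMr.
exists (of_real c (hnorm x)^-1 *: x) => //=.
by rewrite hnormZ_ge0 ?invr_ge0 ?hnorm_ge0 // mulVf // gt_eqF.
Qed.

Lemma opnorm_ge0 (A : X -> Y) : hbounded A -> 0 <= opnorm A.
Proof.
move=> [C C0 AC]; apply: (@le_trans _ _ (hnorm (A 0))); first exact: hnorm_ge0.
apply: ub_le_sup; last by exists 0; rewrite //= hnorm0.
exists C => _ [z /= z1 <-]; apply: le_trans (AC z) _.
by rewrite ler_piMr.
Qed.

Lemma hboundedB (A B : X -> Y) : hbounded A -> hbounded B -> hbounded (A \- B).
Proof.
move=> [C C0 AC] [D D0 BD]; exists (C + D) => [|x]; first exact: addr_ge0.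
by rewrite mulrDl; apply: le_trans (hnormB _ _) _; apply: lerD.
Qed.

End OperatorNorm.

Section MoorePenrose.
Variables (R : realType) (c : scalar_kind) (X Y : hilbert R c).
Variable A : {linear X -> Y}.
Hypothesis mpA : moore_penrose_defined A.

Let bA : hbounded A.
Proof. by case: mpA => /continuous_hbounded. Qed.

Let clA : closed (range A). Proof. by case: mpA. Qed.

Let injA : injective A. Proof. by case: mpA. Qed.

Lemma normal_eq_inj x x' : adjoint A (A x) = adjoint A (A x') -> x = x'.
Proof.
move=> e; apply/injA/eqP; rewrite -subr_eq0; apply/eqP/hnorm0_eq0/eqP.
rewrite -sqrf_eq0 -rinxx -linearB rin_adjoint // linearB.
have /= := adjoint_linear bA (-1) (A x') (A x).
rewrite !scaleN1r addrC => ->.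
by rewrite -e addNr rinC rin0l.
Qed.

(** The normal equations.  They have a solution since the image of [A] is
    closed: it is the preimage of the projection of [y] onto the image. *)
Lemma moore_penrose_normal y :
  adjoint A (A (moore_penrose A y)) = adjoint A y.
Proof.
have [_ [x _ <-] xP] := projection (closed_range_subspace clA) y.
have e : adjoint A (A x) = adjoint A y.
  apply: inner_injr => z; rewrite -!adjointE //; apply/esym/eqP.
  rewrite -subr_eq0; apply/eqP.
  have : inner Y (A z) (y - A x) = 0.
    by rewrite innerC xP ?rmorph0 //; exists z.
  by rewrite linearBr.
rewrite /moore_penrose /=.
by apply: (@pinvK _ _ _ setT (adjoint A \o A)); rewrite inE -e; exists x.
Qed.

Lemma moore_penrose_eq x y : adjoint A (A x) = adjoint A y -> moore_penrose A y = x.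
Proof. by move=> e; apply: normal_eq_inj; rewrite moore_penrose_normal. Qed.

Lemma moore_penroseK x : moore_penrose A (A x) = x.
Proof. exact: moore_penrose_eq. Qed.

Lemma moore_penrose_linear a y z :
  moore_penrose A (a *: y + z) = a *: moore_penrose A y + moore_penrose A z.
Proof.
by apply: moore_penrose_eq; rewrite linearP !adjoint_linear // !moore_penrose_normal.
Qed.

Lemma moore_penrose0 : moore_penrose A 0 = 0.
Proof. by rewrite -[X in moore_penrose A X](linear0 A) moore_penroseK. Qed.

Lemma moore_penroseZ a y : moore_penrose A (a *: y) = a *: moore_penrose A y.
Proof. by have := moore_penrose_linear a y 0; rewrite moore_penrose0 !addr0. Qed.

Lemma moore_penroseB y z :
  moore_penrose A (y - z) = moore_penrose A y - moore_penrose A z.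
Proof. by have := moore_penrose_linear (-1) z y; rewrite !scaleN1r !(addrC (- _)). Qed.

(** With x the image of y under the Moore-Penrose inverse, the normal equations
    say (A x, A x) = (y, A x): this is an orthogonal projection. *)
Lemma hnorm_range_projection y : hnorm (A (moore_penrose A y)) <= hnorm y.
Proof.
have : hnorm (A (moore_penrose A y)) ^+ 2 <= hnorm y * hnorm (A (moore_penrose A y)).
  apply: le_trans (rin_le _ _).
  by rewrite -rinxx (rinC y) !rin_adjoint // moore_penrose_normal.
have := hnorm_ge0 (A (moore_penrose A y)); have := hnorm_ge0 y; nra.
Qed.

Lemma moore_penrose_bounded : hbounded (moore_penrose A).
Proof.
have [C C0 CP] := bounded_below bA clA injA; exists C => // y.
apply: le_trans (CP _) _; apply: ler_wpM2l => //; exact: hnorm_range_projection.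
Qed.

(** Together with [hnorm_range_projection], this makes lower bounds for [A] and
    upper bounds for its Moore-Penrose inverse interchangeable. *)
Lemma moore_penrose_below x : hnorm x <= opnorm (moore_penrose A) * hnorm (A x).
Proof.
rewrite -[in hnorm x](moore_penroseK x); apply: le_opnorm.
  exact: moore_penrose_bounded.
by move=> a y; exact: moore_penroseZ.
Qed.

End MoorePenrose.

(** * A mean value inequality *)

Section RealDerivative.
Variable R : realType.

Lemma is_derive_epsP (s : R -> R) (x l : R) :
  is_derive x 1 s l <->
  forall e : R, 0 < e -> exists2 d : R, 0 < d & forall t, `|t| < d ->
    `|s (x + t) - s x - t * l| <= e * `|t|.
Proof.
split=> [[ds <-] e e0|H].
  have /cvgrPdist_le/(_ e e0) := ds.
  move=> /nbhs_normP[d /= d0 dP]; exists d => // t td.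
  have [->|t0] := eqVneq t 0.
    by rewrite addr0 subrr mul0r subr0 normr0 mulr0.
  have := dP t; rewrite /= sub0r normrN => /(_ td t0).
  rewrite [t%:A]mulr1 (addrC t) => h.
  have -> : s (x + t) - s x - t * 'D_1 s x =
      - ('D_1 s x - t^-1 * (s (x + t) - s x)) * t.
    by rewrite opprB mulrBl mulrAC mulVf // mul1r (mulrC t).
  by rewrite normrM normrN ler_wpM2r.
have cv : (fun h => h^-1 *: ((s \o shift x) (h *: (1 : R)) - s x)) @ (0 : R)^' --> l.
  apply/cvgrPdist_le => e e0; have [d d0 dP] := H e e0.
  apply/nbhs_normP; exists d => // t /=; rewrite sub0r normrN => td t0.
  have := dP t td; rewrite [t%:A]mulr1 /= (addrC t) => h.
  have -> : l - t^-1 *: (s (x + t) - s x) = - (s (x + t) - s x - t * l) / t.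
    by rewrite opprB mulrBl [_ *: _]mulrC mulrAC divff // mul1r.
  by rewrite normrM normrN normfV ler_pdivrMr ?normr_gt0.
by split; [apply: cvgP cv | apply: cvg_lim cv].
Qed.

(** The odd function t |t|^p is used in place of t^(p+1) because it is
    differentiable on the whole line, also at 0. *)
Lemma is_derive_signed_powR (p x : R) : 0 < p ->
  is_derive x 1 (fun t : R => t * `|t| `^ p) ((p + 1) * `|x| `^ p).
Proof.
move=> p0; have p1 : 0 < p + 1 by rewrite addr_gt0.
have pos (y : R) : 0 < y ->
    is_derive y 1 (fun t : R => t * `|t| `^ p) ((p + 1) * `|y| `^ p).
  move=> y0; apply: (@near_eq_is_derive _ _ _ (fun t => t `^ (p + 1))).
  - near=> t; have t0 : 0 < t by near: t; exact: lt_nbhsr.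
    rewrite ger0_norm ?ltW // powRD ?powRr1 ?(ltW t0) 1?mulrC //.
    by rewrite (gt_eqF p1).
  - rewrite ger0_norm ?ltW //.
    apply: is_derive_eq; first exact: is_derive1_powR.
    by rewrite addrK.
have [x0|x0|<-] := ltgtP 0 x; first exact: pos.
- apply/is_derive_epsP => e e0.
  have /pos/is_derive_epsP/(_ e e0)[d d0 dP] : 0 < - x by rewrite oppr_gt0.
  exists d => // t td; have := dP (- t); rewrite normrN => /(_ td).
  rewrite -opprD !normrN => h.
  rewrite -[X in X <= _]normrN; apply: le_trans h.
  by rewrite le_eqVlt; apply/orP; left; apply/eqP; congr (`|_|); ring.
- apply/is_derive_epsP => e e0.
  exists (e `^ p^-1) => [|t td]; first exact: powR_gt0.
  rewrite add0r !mul0r normr0 powR0 ?gt_eqF // !mulr0 !subr0 normrM mulrC.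
  rewrite ler_wpM2r // ger0_norm ?powR_ge0 //.
  have -> : e = (e `^ p^-1) `^ p by rewrite -powRrM mulVf ?powRr1 ?ltW // gt_eqF.
  by rewrite ge0_ler_powR ?nnegrE ?powR_ge0 // ltW.
Unshelve. all: by end_near. Qed.

(** Away from 0 the function is the quotient of the differentiable function
    t |t|^p by t. *)
Lemma continuous_norm_powR (p : R) : 0 < p ->
  continuous (fun t : R => `|t| `^ p).
Proof.
move=> p0 x; have [->|x0] := eqVneq x 0.
  apply/cvgrPdist_le => e e0; apply/nbhs_normP; exists (e `^ p^-1) => /=.
    exact: powR_gt0.
  move=> t /=; rewrite sub0r normrN => td.
  rewrite normr0 powR0 ?gt_eqF // sub0r normrN ger0_norm ?powR_ge0 //.
  have -> : e = (e `^ p^-1) `^ p by rewrite -powRrM mulVf ?powRr1 ?ltW // gt_eqF.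
  by rewrite ge0_ler_powR ?nnegrE ?powR_ge0 // ltW.
have [dG _] := is_derive_signed_powR x p0.
have cG := differentiable_continuous (proj1 (derivable1_diffP _ _) dG).
have : (fun t : R => t * `|t| `^ p * t^-1) t @[t --> x] --> x * `|x| `^ p * x^-1.
  by apply: cvgM => //; exact: cvgV.
rewrite mulrAC divff // mul1r; apply: cvg_trans; apply: near_eq_cvg.
near=> t; rewrite mulrAC divff ?mul1r //; near: t; apply: cvgr_neq0 x0; exact: cvg_id.
Unshelve. all: by end_near. Qed.

End RealDerivative.

Section MeanValue.
Variables (R : realType) (c : scalar_kind) (X Y : hilbert R c).

Lemma diff_hnorm (F : X -> Y) x : differentiable F x ->
  forall e : R, 0 < e -> exists2 d : R, 0 < d & forall h : X, hnorm h < d ->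
    hnorm (F (x + h) - F x - 'd F x h) <= e * hnorm h.
Proof.
move=> dF e e0; have /eqaddoP := diff_locally dF.
move=> /(_ (of_real c e)); rewrite of_real_gt0 => /(_ e0).
move=> /nbhs_hnorm[d d0 dP]; exists d => // h hd.
have := dP h; rewrite subr0 => /(_ hd) /sRe_le.
rewrite /= -(hnorm_of_real h) -of_realM sRe_of_real.
by rewrite (addrC x) -addrA -opprD.
Qed.

(** Pairing with a fixed vector turns a map between real or complex spaces into
    a real function of a real variable, whatever the scalars are. *)
Lemma is_derive_rin_line (F : X -> Y) (x h : X) (w : Y) (t : R) :
  differentiable F (x + of_real c t *: h) ->
  is_derive t 1 (fun u : R => rin (F (x + of_real c u *: h)) w)
    (rin ('d F (x + of_real c t *: h) h) w).
Proof.
move=> dF; apply/is_derive_epsP => e e0.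
pose k := hnorm h * hnorm w + 1.
have hw := mulr_ge0 (hnorm_ge0 h) (hnorm_ge0 w).
have k0 : 0 < k by rewrite ltr_wpDl.
have [|d d0 dP] := diff_hnorm dF (e := e / k); first by rewrite divr_gt0.
exists (d / (hnorm h + 1)) => [|u ud].
  by rewrite divr_gt0 // ltr_wpDl // hnorm_ge0.
have /dP : hnorm (of_real c u *: h) < d.
  rewrite hnormZ; move: ud; rewrite ltr_pdivlMr ?ltr_wpDl ?hnorm_ge0 //.
  by apply: le_lt_trans; rewrite ler_wpM2l // lerDl.
rewrite linearZ /= -(addrA x) -scalerDl -of_realD => b.
rewrite -rinZl -!rinBl.
apply: (le_trans (rin_abs_le _ _)).
apply: (le_trans (ler_wpM2r (hnorm_ge0 w) b)).
rewrite hnormZ.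
have -> : e / k * (`|u| * hnorm h) * hnorm w =
  e * `|u| * (hnorm h * hnorm w / k) by ring.
apply: ler_piMr; first by rewrite mulr_ge0 // ltW.
by rewrite ler_pdivrMr // mul1r /k lerDl.
Qed.

(** This stands for the integral estimate
    |int_0^1 (v - F'(x + t h) h) dt| <= int_0^1 (a + b t^p) dt
    without vector-valued integrals: pair with w = v - (F(x+h) - F(x)) and
    apply the real mean value theorem to the difference of both sides. *)
Lemma mean_value_powR (F : X -> Y) (x h : X) (v : Y) (a b p : R) : 0 < p ->
  (forall t : R, 0 <= t <= 1 -> differentiable F (x + of_real c t *: h)) ->
  (forall t : R, 0 <= t <= 1 ->
     hnorm (v - 'd F (x + of_real c t *: h) h) <= a + b * t `^ p) ->
  hnorm (v - (F (x + h) - F x)) <= a + b / (p + 1).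
Proof.
move=> p0 dF bF; set w := v - _.
have p1 : 0 < p + 1 by lra.
pose s t := rin v w * t - rin (F (x + of_real c t *: h)) w
  - hnorm w * (a * t + b / (p + 1) * (t * `|t| `^ p)).
pose ds t := rin v w - rin ('d F (x + of_real c t *: h) h) w
  - hnorm w * (a + b * `|t| `^ p).
have sP (t : R) : 0 <= t <= 1 -> is_derive t 1 s (ds t).
  move=> /dF dFt; have d1 := is_derive_rin_line w dFt.
  have d2 := is_derive_signed_powR t p0.
  have d3 (k : R) (g : R -> R) (dg : R) : is_derive t 1 g dg ->
      is_derive t 1 (fun u => k * g u) (k * dg).
    exact: is_deriveZ.
  have id' : is_derive t 1 (fun u : R => u) 1 by exact: is_derive_id.
  have := is_deriveB (is_deriveB (d3 (rin v w) _ _ id') d1)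
    (d3 (hnorm w) _ _ (is_deriveD (d3 a _ _ id') (d3 (b / (p + 1)) _ _ d2))).
  move/is_derive_eq; apply; rewrite /ds !mulr1.
  by congr (_ - _ * (_ + _)); field; rewrite gt_eqF.
have [u u01] : exists2 u, u \in `]0, 1[ & s 1 - s 0 = ds u * (1 - 0).
  apply: MVT => [//|t|].
    by rewrite in_itv /= => /andP[? ?]; apply: sP; rewrite !ltW.
  by apply: derivable_within_continuous => t; rewrite in_itv /= => /sP[].
move: u01; rewrite in_itv /= => /andP[u0 u1].
have u01 : 0 <= u <= 1 by rewrite !ltW.
rewrite subr0 mulr1 /s /ds.
rewrite of_real1 of_real0 scale1r scale0r addr0 !mul0r normr1 powR1 !mulr1.
rewrite !mulr0 addr0 mulr0 sub0r subr0 opprK (ger0_norm (ltW u0)) => e.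
have := rin_le (v - 'd F (x + of_real c u *: h) h) w; rewrite rinBl => h1.
have h2 := ler_wpM2r (hnorm_ge0 w) (bF u u01).
have ww : hnorm w ^+ 2 = rin v w - (rin (F (x + h)) w - rin (F x) w).
  by rewrite -rinxx {1}/w !rinBl.
have : hnorm w ^+ 2 <= hnorm w * (a + b / (p + 1)) by lra.
have [w0|w0] := eqVneq (hnorm w) 0; last first.
  have wp : 0 < hnorm w by rewrite lt_neqAle eq_sym w0 hnorm_ge0.
  by rewrite expr2 ler_pM2l.
(* when w = 0 it remains to see that the bound is nonnegative; it is a convex
   combination of the bounds at t = 0 and t = 1 *)
rewrite w0 => _.
have a0 := bF 0; have b1 := bF 1; move: a0 b1.
rewrite powR0 ?gt_eqF // mulr0 addr0 powR1 mulr1 !lexx ler01 => a0 b1.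
have {}a0 := le_trans (hnorm_ge0 _) (a0 isT).
have {}b1 := le_trans (hnorm_ge0 _) (b1 isT).
have -> : a + b / (p + 1) = (p * a + (a + b)) / (p + 1) by field; rewrite gt_eqF.
apply: divr_ge0; last exact: ltW.
by apply: addr_ge0 => //; apply: mulr_ge0 => //; exact: ltW.
Qed.

End MeanValue.

(** * The majorant sequence *)

Section Majorant.
Variables (R : realType) (K p : R).
Hypotheses (K0 : 0 < K) (p0 : 0 < p).

Lemma powR_root_lt (t a : R) : 0 <= t -> 0 < a ->
  (t < a `^ p^-1) = (t `^ p < a).
Proof.
move=> t0 a0.
rewrite -[in RHS](_ : (a `^ p^-1) `^ p = a); last first.
  by rewrite -powRrM mulVf ?powRr1 ?ltW // gt_eqF.
apply/idP/idP => [ta|]; first by rewrite gt0_ltr_powR ?nnegrE ?powR_ge0.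
by apply: contraTT; rewrite -!leNgt => at_; rewrite ge0_ler_powR ?nnegrE ?powR_ge0 // ltW.
Qed.

Definition newton_factor (t : R) : R := K * p / ((p + 1) * (1 - K * t `^ p)).

Lemma powR_succ (t : R) : 0 <= t -> t `^ (p + 1) = t `^ p * t.
Proof.
move=> t0; rewrite powRD ?powRr1 //; apply/implyP => /eqP.
by move: p0 => /[swap] h; lra.
Qed.

Lemma newton_factor_ge0 t : K * t `^ p < 1 -> 0 <= newton_factor t.
Proof.
move=> t1; apply: divr_ge0; first by rewrite mulr_ge0 ?ltW.
by apply: mulr_ge0; [have := p0; lra | lra].
Qed.

Lemma newton_factor_le s t : 0 <= s -> s <= t -> K * t `^ p < 1 ->
  newton_factor s <= newton_factor t.
Proof.
move=> s0 st t1; rewrite /newton_factor; apply: ler_wpM2l.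
  by rewrite mulr_ge0 ?ltW.
have p1 : 0 < p + 1 by rewrite addr_gt0.
have stp : K * s `^ p <= K * t `^ p.
  by rewrite ler_pM2l // ge0_ler_powR ?nnegrE ?(ltW p0) // (le_trans s0).
rewrite lef_pV2 ?posrE ?mulr_gt0 //; last 2 first.
- by lra.
- by lra.
by rewrite ler_pM2l //; lra.
Qed.

Variable t0 : R.
Hypotheses (t0_gt0 : 0 < t0) (t0_lt : (2 * p + 1) * K * t0 `^ p < p + 1).

Let p1 : 0 < p + 1. Proof. by rewrite addr_gt0. Qed.

Let Kt0 : K * t0 `^ p < 1.
Proof.
rewrite ltNge; apply/negP => h.
have p2 : 0 <= 2 * p + 1 by have := p0; lra.
have := ler_wpM2l p2 h; have := t0_lt; have := p0; rewrite mulrA mulr1; lra.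
Qed.

Let q : R := newton_factor t0 * t0 `^ p.

(** The condition on [t0] is equivalent to [q < 1]. *)
Lemma majorant_ratio : 0 <= q < 1.
Proof.
rewrite /q mulr_ge0 ?newton_factor_ge0 ?powR_ge0 //= /newton_factor mulrAC.
rewrite ltr_pdivrMr ?mulr_gt0 ?subr_gt0 //.
by rewrite mul1r; have := t0_lt; lra.
Qed.

Lemma majorant_step t : 0 < t -> t <= t0 ->
  0 < newton_factor t * t `^ (p + 1) <= q * t.
Proof.
move=> tp tt0; have tp' : t `^ p <= t0 `^ p.
  by rewrite ge0_ler_powR ?nnegrE ?(ltW p0) // ltW.
have Kt : K * t `^ p < 1.
  by apply: le_lt_trans Kt0; rewrite ler_pM2l.
apply/andP; split.
  rewrite mulr_gt0 ?powR_gt0 // /newton_factor divr_gt0 ?mulr_gt0 ?subr_gt0 //.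
rewrite (powR_succ (ltW tp)) mulrA (ler_pM2r tp) /q.
by apply: ler_pM; rewrite ?newton_factor_ge0 ?powR_ge0 ?newton_factor_le // ltW.
Qed.

Let t := majorant_seq K p t0.

Lemma majorant_seqS k : t k.+1 = newton_factor (t k) * t k `^ (p + 1).
Proof. by rewrite /t /= /newton_factor mulrAC. Qed.

Lemma majorant_bounds k : 0 < t k <= t0.
Proof.
elim: k => [|k /andP[IH1 IH2]]; first by rewrite /t /= t0_gt0 lexx.
have /andP[h1 h2] := majorant_step IH1 IH2; rewrite majorant_seqS h1 /=.
apply: (le_trans h2); have /andP[q0 q1] := majorant_ratio; nra.
Qed.

Lemma majorant_Klt1 k : K * t k `^ p < 1.
Proof.
have /andP[h1 h2] := majorant_bounds k; apply: le_lt_trans Kt0.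
by rewrite ler_pM2l // ge0_ler_powR ?nnegrE ?(ltW p0) // ltW.
Qed.

Lemma majorant_decr k : t k.+1 < t k.
Proof.
have /andP[h1 h2] := majorant_bounds k.
have /andP[_ h3] := majorant_step h1 h2; rewrite majorant_seqS.
apply: (le_lt_trans h3); have /andP[q0 q1] := majorant_ratio.
by rewrite gtr_pMl.
Qed.

Lemma majorant_cvg : t k @[k --> \oo] --> (0 : R).
Proof.
have /andP[q0 q1] := majorant_ratio.
have tq k : t k <= q ^+ k * t0.
  elim: k => [|k IH]; first by rewrite /t /= expr0 mul1r.
  have /andP[h1 h2] := majorant_bounds k.
  have /andP[_ h3] := majorant_step h1 h2; rewrite majorant_seqS.
  by apply: (le_trans h3); rewrite exprS -mulrA ler_wpM2l.
apply: (@squeeze_cvgr _ _ _ _ (fun=> 0) (fun k => q ^+ k * t0)).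
- by near=> k; rewrite tq andbT ltW //; have /andP[] := majorant_bounds k.
- exact: cvg_cst.
- have -> : (0 : R) = 0 * t0 by rewrite mul0r.
  by apply: cvgM; [apply: cvg_expr; rewrite ger0_norm | exact: cvg_cst].
Unshelve. all: by end_near. Qed.

Variable e : nat -> R.
Hypotheses (e_ge0 : forall k, 0 <= e k) (e_0 : e 0%N = t0).
Hypothesis e_step : forall k, e k <= t k ->
  e k.+1 <= newton_factor (e k) * e k `^ (p + 1).

Lemma error_majorized k : e k <= t k.
Proof.
elim: k => [|k IH]; first by rewrite e_0.
apply: (le_trans (e_step IH)); rewrite majorant_seqS.
apply: ler_pM; rewrite ?powR_ge0 //.
- apply: newton_factor_ge0; apply: le_lt_trans (majorant_Klt1 k).
  by rewrite ler_pM2l // ge0_ler_powR ?nnegrE ?(ltW p0) ?e_ge0 // (le_trans (e_ge0 k)).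
- exact: newton_factor_le (e_ge0 k) IH (majorant_Klt1 k).
- by rewrite ge0_ler_powR ?nnegrE ?(ltW p1) ?e_ge0 // (le_trans (e_ge0 k)).
Qed.

Lemma error_step_majorant k : e k.+1 <= newton_factor (t k) * e k `^ (p + 1).
Proof.
apply: (le_trans (e_step (error_majorized k))).
rewrite ler_wpM2r ?powR_ge0 //.
exact: newton_factor_le (e_ge0 k) (error_majorized k) (majorant_Klt1 k).
Qed.

Lemma majorant_factor_le k :
  newton_factor (t k) * e k `^ (p + 1) <= newton_factor t0 * e k `^ (p + 1).
Proof.
have /andP[h1 h2] := majorant_bounds k.
by rewrite ler_wpM2r ?powR_ge0 // newton_factor_le // ltW.
Qed.

(** The exponents s_k = ((p + 1)^k - 1) / p satisfy s_(k+1) = (p + 1) s_k + 1;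
    the summand 1 is the factor [q] gained in each step. *)
Lemma error_superlinear k : e k <= q `^ (((p + 1) ^+ k - 1) / p) * t0.
Proof.
have /andP[q0 q1] := majorant_ratio.
elim: k => [|k IH]; first by rewrite expr0 subrr mul0r powRr0 mul1r e_0.
apply: (le_trans (error_step_majorant k)); apply: (le_trans (majorant_factor_le k)).
set s := _ / p in IH.
have h : e k `^ (p + 1) <= (q `^ s * t0) `^ (p + 1).
  rewrite ge0_ler_powR ?nnegrE ?(ltW p1) ?e_ge0 //.
  by rewrite mulr_ge0 ?powR_ge0 ?ltW.
apply: (le_trans (ler_wpM2l (newton_factor_ge0 Kt0) h)).
rewrite powRM ?powR_ge0 ?(ltW t0_gt0) // (powR_succ (ltW t0_gt0)) -powRrM.
have -> : newton_factor t0 * (q `^ (s * (p + 1)) * (t0 `^ p * t0)) =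
  q `^ (s * (p + 1)) * q * t0 by rewrite /q; ring.
rewrite ler_wpM2r ?(ltW t0_gt0) //.
have pk : 1 <= (p + 1) ^+ k by rewrite exprn_ege1 // lerDr ltW.
have s0 : 0 <= s by rewrite divr_ge0 ?subr_ge0 // ltW.
rewrite -[X in _ * X]powRr1 // -powRD; last first.
  apply/implyP => /eqP; have := mulr_ge0 s0 (ltW p1); lra.
suff -> : s * (p + 1) + 1 = ((p + 1) ^+ k.+1 - 1) / p by [].
by rewrite exprS /s; field; rewrite gt_eqF.
Qed.

End Majorant.

Lemma lt_radius_cond (R : realType) (K p t : R) : 0 < K -> 0 < p -> 0 <= t ->
  t < ((p + 1) / ((2 * p + 1) * K)) `^ p^-1 ->
  (2 * p + 1) * K * t `^ p < p + 1.
Proof.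
move=> K0 p0 t0.
have d0 : 0 < (2 * p + 1) * K by rewrite mulr_gt0 // addr_gt0 // mulr_gt0.
by rewrite powR_root_lt // ?divr_gt0 ?addr_gt0 // ltr_pdivlMr // mulrC.
Qed.

(** * Estimates for one problem *)

Section Estimates.
Variables (R : realType) (c : scalar_kind) (X Y : hilbert R c).
Variables (Omega : set X) (F : X -> Y) (xs : X) (rad K p : R).
Hypothesis hF : holder_problem Omega F xs rad K p.

Let kappa := kappa_of Omega xs rad.
Let beta := opnorm (moore_penrose ('d F xs)).
Let K0 : 0 < K := hp_K hF.
Let p0 : 0 < p. Proof. by case/andP: (hp_p hF). Qed.
Let p1 : 0 < p + 1. Proof. by rewrite addr_gt0. Qed.

Lemma ball_kappa_subset x : hball xs kappa x -> Omega x.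
Proof.
rewrite /hball /= => xk; apply: contrapT => nOx.
move: xk; apply/negP; rewrite -leNgt /kappa /kappa_of; apply: ge_sup.
  exists 0; split; first by rewrite lexx (hp_rad hF).
  by move=> y; rewrite /hball /= ltNge hnorm_ge0.
move=> t [_ tO]; rewrite leNgt; apply/negP => xt; apply: nOx; exact: tO.
Qed.

Lemma ball_kappa_star_shaped x (t : R) : hball xs kappa x -> 0 <= t <= 1 ->
  hball xs kappa (xs + of_real c t *: (x - xs)).
Proof.
rewrite /hball /= => xk /andP[t0 t1]; rewrite addrC addrA addNr add0r.
by rewrite hnormZ_ge0 //; apply: le_lt_trans xk; rewrite ler_piMl ?hnorm_ge0.
Qed.

Lemma diff_hbounded x : Omega x -> hbounded ('d F x).
Proof.
move=> /(hp_diff hF) dF; apply: continuous_hbounded; exact: diff_continuous.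
Qed.

Lemma moore_penrose_defined_xs : moore_penrose_defined ('d F xs).
Proof.
split; [|exact: hp_inj hF|exact: (hp_closed hF (hp_xs hF))].
by apply: diff_continuous; exact: (hp_diff hF (hp_xs hF)).
Qed.

Let beta0 : 0 <= beta.
Proof. by apply: opnorm_ge0; exact: moore_penrose_bounded moore_penrose_defined_xs. Qed.

Lemma derivative_below_xs h : hnorm h <= beta * hnorm ('d F xs h).
Proof. exact: moore_penrose_below moore_penrose_defined_xs h. Qed.

Lemma beta_gt0 (h : X) : h <> 0 -> 0 < beta.
Proof.
move=> /hnorm_gt0 h0; rewrite lt_neqAle beta0 andbT; apply/eqP => b0.
by have := derivative_below_xs h; rewrite -b0 mul0r leNgt h0.
Qed.

Lemma holder_bound x t h : hball xs kappa x -> 0 <= t <= 1 ->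
  beta * hnorm ('d F x h - 'd F (xs + of_real c t *: (x - xs)) h)
    <= K * (1 - t `^ p) * hnorm (x - xs) `^ p * hnorm h.
Proof.
move=> xk t01; apply: le_trans (ler_wpM2r (hnorm_ge0 h) (hp_holder hF xk t01)).
rewrite -mulrA ler_wpM2l //.
apply: (@le_opnorm _ _ _ _ ('d F x \- 'd F (xs + of_real c t *: (x - xs)))).
  apply: hboundedB; apply: diff_hbounded; apply: ball_kappa_subset => //.
  exact: ball_kappa_star_shaped.
by move=> a z; rewrite /= [RHS]scalerBr; congr (_ - _); exact: linearZ.
Qed.

(** The perturbation argument: at [tau = 0] the Hölder condition bounds
    beta |F'(x) - F'(xs)| by K |x - xs|^p. *)
Lemma derivative_below x h : hball xs kappa x ->
  (1 - K * hnorm (x - xs) `^ p) * hnorm h <= beta * hnorm ('d F x h).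
Proof.
move=> xk; have t01 : 0 <= (0 : R) <= 1 by rewrite lexx ler01.
have := holder_bound h xk t01.
rewrite of_real0 scale0r addr0 powR0 ?gt_eqF // subr0 mulr1 => h1.
have h2 := derivative_below_xs h.
have := ler_wpM2l beta0 (hnorm_triangle ('d F x h) ('d F xs h) 0).
rewrite !subr0 (hnormBC ('d F xs h)); lra.
Qed.

Lemma derivative_moore_penrose_defined x : hball xs kappa x ->
  K * hnorm (x - xs) `^ p < 1 -> moore_penrose_defined ('d F x).
Proof.
move=> xk Kx; have Ox := ball_kappa_subset xk.
split; [by apply: diff_continuous; exact: hp_diff hF _ Ox| |exact: hp_closed hF _ Ox].
move=> u v uv; apply/eqP; rewrite -subr_eq0; apply/eqP/hnorm0_eq0.
have := derivative_below (u - v) xk; rewrite linearB uv subrr hnorm0 mulr0.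
rewrite pmulr_rle0 ?subr_gt0 // => h; apply/le_anti; rewrite h hnorm_ge0 //.
Qed.

(** Both the inverse and the linearisation error are estimated after
    multiplication by [beta], which cancels in the end. *)
Lemma newton_step x : hball xs kappa x -> K * hnorm (x - xs) `^ p < 1 ->
  hnorm (x - moore_penrose ('d F x) (F x) - xs)
    <= newton_factor K p (hnorm (x - xs)) * hnorm (x - xs) `^ (p + 1).
Proof.
move=> xk Kx; set h := x - xs in Kx *.
have xsh : xs + h = x by rewrite /h addrC subrK.
have mpx := derivative_moore_penrose_defined xk Kx.
have [h0|/eqP h0] := eqVneq h 0.
  have xxs : x = xs by apply/eqP; rewrite -subr_eq0 -/h h0.
  have -> : x - moore_penrose ('d F x) (F x) - xs = 0.
    by rewrite xxs (hp_zero hF) moore_penrose0 -?xxs // subr0 subrr.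
  by rewrite hnorm0 mulr_ge0 ?powR_ge0 // newton_factor_ge0.
have b0 := beta_gt0 h0; have nh := hnorm_gt0 h0.
have -> : x - moore_penrose ('d F x) (F x) - xs
    = moore_penrose ('d F x) ('d F x h - F x).
  by rewrite moore_penroseB // moore_penroseK // addrAC.
set w := 'd F x h - F x.
pose a := K * hnorm h `^ p * hnorm h / beta.
have wle : hnorm w <= a + - a / (p + 1).
  have -> : w = 'd F x h - (F (xs + h) - F xs).
    by rewrite (hp_zero hF) subr0 xsh.
  apply: mean_value_powR => // t t01.
    by apply: (hp_diff hF); apply: ball_kappa_subset; exact: ball_kappa_star_shaped.
  rewrite -(ler_pM2l b0); apply: (le_trans (holder_bound h xk t01)).
  by rewrite -/h le_eqVlt; apply/orP; left; apply/eqP; rewrite /a; field; rewrite gt_eqF.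
have h1 := derivative_below (moore_penrose ('d F x) w) xk; rewrite -/h in h1.
have h2 := ler_wpM2l beta0 (hnorm_range_projection mpx w).
have h3 := ler_wpM2l beta0 wle.
have K1 : 0 < 1 - K * hnorm h `^ p by rewrite subr_gt0.
rewrite -(ler_pM2l K1); apply: (le_trans h1); apply: (le_trans h2).
apply: (le_trans h3); rewrite powR_succ ?hnorm_ge0 //.
rewrite le_eqVlt; apply/orP; left; apply/eqP; rewrite /a /newton_factor.
by field; rewrite !gt_eqF.
Qed.

(** The Hölder condition is applied at the points xs + t (x - xs) with
    [tau = 0], which gives K t^p |x - xs|^p, with integral
    K |x - xs|^p / (p + 1). *)
Lemma zero_unique x : hball xs kappa x ->
  K * hnorm (x - xs) `^ p < p + 1 -> F x = 0 -> x = xs.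
Proof.
move=> xk Kx Fx; set h := x - xs in Kx.
have xsh : xs + h = x by rewrite /h addrC subrK.
have [h0|/eqP h0] := eqVneq h 0; first by apply/eqP; rewrite -subr_eq0 -/h h0.
have b0 := beta_gt0 h0; have nh := hnorm_gt0 h0; exfalso.
pose b := K * hnorm h `^ p * hnorm h / beta.
have wle : hnorm ('d F xs h - (F (xs + h) - F xs)) <= 0 + b / (p + 1).
  apply: mean_value_powR => // t t01.
    by apply: (hp_diff hF); apply: ball_kappa_subset; exact: ball_kappa_star_shaped.
  rewrite -(ler_pM2l b0) hnormBC.
  have z01 : 0 <= (0 : R) <= 1 by rewrite lexx ler01.
  have := holder_bound h (ball_kappa_star_shaped xk t01) z01.
  rewrite of_real0 scale0r addr0 powR0 ?gt_eqF // subr0 mulr1 -/h => h1.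
  apply: (le_trans h1); rewrite addrC addrA addNr add0r.
  case/andP: t01 => t0 _.
  rewrite hnormZ_ge0 // powRM ?hnorm_ge0 // le_eqVlt; apply/orP; left; apply/eqP.
  by rewrite /b; field; rewrite gt_eqF.
move: wle; rewrite (hp_zero hF) xsh Fx !subr0 add0r => wle.
have := le_trans (derivative_below_xs h) (ler_wpM2l beta0 wle).
have -> : beta * (b / (p + 1)) = K * hnorm h `^ p / (p + 1) * hnorm h.
  by rewrite /b; field; rewrite !gt_eqF.
by rewrite leNgt gtr_pMl // ltr_pdivrMr // mul1r Kx.
Qed.

End Estimates.

(** * Convergence of the Gauss-Newton iteration *)

Section LocalConvergence.
Variables (R : realType) (c : scalar_kind) (X Y : hilbert R c).
Variables (Omega : set X) (F : X -> Y) (xs : X) (rad K p : R).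
Hypothesis hF : holder_problem Omega F xs rad K p.
Let kappa := kappa_of Omega xs rad.
Let K0 : 0 < K := hp_K hF.
Let p0 : 0 < p. Proof. by case/andP: (hp_p hF). Qed.
Let p1 : 0 < p + 1. Proof. by rewrite addr_gt0. Qed.

Variable x0 : X.
Hypotheses (x0k : hball xs kappa x0) (x0xs : x0 <> xs).
Let t0 := hnorm (x0 - xs).
Hypothesis t0_lt : (2 * p + 1) * K * t0 `^ p < p + 1.

Let x := gauss_newton F x0.
Let t := majorant_seq K p t0.
Let e k := hnorm (x k - xs).

Let t0_gt0 : 0 < t0.
Proof.
by apply: hnorm_gt0 => /eqP; rewrite subr_eq0 => /eqP.
Qed.

Let in_ball k : e k <= t k -> hball xs kappa (x k) /\ K * e k `^ p < 1.
Proof.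
move=> ek; split.
  apply: (le_lt_trans ek); apply: le_lt_trans x0k.
  by have /andP[] := majorant_bounds K0 p0 t0_gt0 t0_lt k.
apply: le_lt_trans (majorant_Klt1 K0 p0 t0_gt0 t0_lt k).
rewrite ler_pM2l // ge0_ler_powR ?nnegrE ?(ltW p0) ?hnorm_ge0 //.
by apply: le_trans ek; exact: hnorm_ge0.
Qed.

Lemma error_recurrence k : e k <= t k ->
  e k.+1 <= newton_factor K p (e k) * e k `^ (p + 1).
Proof. by move=> /in_ball[xk Kx]; exact: (newton_step hF xk Kx). Qed.

Lemma error_le_majorant k : e k <= t k.
Proof.
apply: error_majorized => //; [by move=> ?; exact: hnorm_ge0 | exact: error_recurrence].
Qed.

Lemma iterates_defined : gauss_newton_defined Omega F x0.
Proof.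
move=> k; have [xk Kx] := in_ball (error_le_majorant k).
split; first exact: (ball_kappa_subset hF xk).
exact: (derivative_moore_penrose_defined hF xk Kx).
Qed.

Lemma iterates_cvg : x k @[k --> \oo] --> xs.
Proof.
apply/hcvgP => eps eps0.
have /cvgrPdist_lt/(_ eps eps0)[N _ NP] := majorant_cvg K0 p0 t0_gt0 t0_lt.
exists N => n /NP /=; rewrite sub0r normrN => h.
apply: le_lt_trans (error_le_majorant n) _; apply: le_lt_trans h.
exact: ler_norm.
Qed.

End LocalConvergence.

(** * The real line as a Hilbert space *)

Section RealLine.
Variable R : realType.
Local Notation S := (scalar_field R RealScalars).

Definition line_inner (x y : R^o) : R := x * y.

Fact line_inner_bilinear :
  bilinear_for *%R ((@sconj R RealScalars) \; *%R) (line_inner : R^o -> R^o -> S).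
Proof.
split=> u a x y; rewrite /line_inner /= ?mulrDl ?mulrDr /GRing.scale /=.
  by rewrite mulrA.
by rewrite mulrCA.
Qed.

HB.instance Definition _ := @bilinear_isBilinear.Build S (R^o : lmodType S)
  (R^o : lmodType S) S *%R ((@sconj R RealScalars) \; *%R)
  (line_inner : R^o -> R^o -> S) line_inner_bilinear.

Fact line_inner_hermitian (x y : R^o) :
  line_inner x y = (-1) ^+ false * @sconj R RealScalars (line_inner y x).
Proof. by rewrite expr0 mul1r /line_inner /= mulrC. Qed.

HB.instance Definition _ := @isHermitianSesquilinear.Build S (R^o : lmodType S)
  false (@sconj R RealScalars) (line_inner : R^o -> R^o -> S) line_inner_hermitian.

Fact line_inner_gt0 (x : R^o) : x != 0 -> 0 < line_inner x x.
Proof. by move=> x0; rewrite /line_inner -expr2 exprn_even_gt0. Qed.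

HB.instance Definition _ := @isDotProduct.Build S (R^o : lmodType S)
  (line_inner : R^o -> R^o -> S) line_inner_gt0.

Fact line_inner_norm (x : R^o) : `|x| ^+ 2 = line_inner x x.
Proof. by rewrite real_normK ?num_real // expr2. Qed.

Definition real_line : hilbert R RealScalars :=
  @Hilbert R RealScalars (R^o : completeNormedModType S) line_inner line_inner_norm.

End RealLine.

(** * Optimality of the radius *)

Section SharpExample.
Variables (R : realType) (K p kappa : R).
Hypotheses (K0 : 0 < K) (p01 : 0 < p <= 1) (kappa0 : 0 < kappa).
Let p0 : 0 < p. Proof. by case/andP: p01. Qed.
Let p1 : 0 < p + 1. Proof. by rewrite addr_gt0. Qed.
Local Notation L := (real_line R).

(** Its derivative 1 - K |x|^p turns the Hölder condition at 0 into an
    equality. *)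
Definition sharp_fun (x : L) : L :=
  (x : R) - K / (p + 1) * ((x : R) * `|(x : R)| `^ p).

Let dsharp (x : R) : R := 1 - K * `|x| `^ p.

Lemma hnorm_line (x : L) : hnorm x = `|x : R|.
Proof. by []. Qed.

Lemma is_derive_sharp (x : R) : is_derive x (1 : R) (sharp_fun : R -> R) (dsharp x).
Proof.
have d1 : is_derive x (1 : R) (fun u : R => u) 1 by exact: is_derive_id.
have d2 := is_deriveZ (K / (p + 1)) (is_derive_signed_powR x p0).
move: (is_deriveB d1 d2) => /is_derive_eq; apply.
by rewrite /dsharp /GRing.scale /=; congr (_ - _); field; rewrite gt_eqF.
Qed.

Lemma differentiable_sharp (x : L) : differentiable sharp_fun x.
Proof.
have [d _] := is_derive_sharp x.
exact: (proj1 (derivable1_diffP (sharp_fun : R -> R^o) x) d).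
Qed.

Lemma diff_sharp (x h : L) : 'd sharp_fun x h = (dsharp x * (h : R)) :> R.
Proof.
have [d dv] := is_derive_sharp x.
have := deriv1E d; rewrite derive1E dv => e.
have -> : 'd sharp_fun x h = ('d (sharp_fun : R -> R^o) x) h by [].
by rewrite e /GRing.scale /= mulrC.
Qed.

Lemma diff_sharp_hbounded (x : L) : hbounded ('d sharp_fun x).
Proof.
by apply: continuous_hbounded; apply: diff_continuous; exact: differentiable_sharp.
Qed.

Lemma closed_range_diff_sharp (x : L) : closed (range ('d sharp_fun x)).
Proof.
have [d0|d0] := eqVneq (dsharp x) 0.
  have -> : range ('d sharp_fun x) = [set (0 : L)].
    apply/seteqP; split => [_ [h _ <-]|_ ->] /=; first by rewrite diff_sharp d0 mul0r.
    by exists 0 => //; rewrite linear0.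
  apply: accessible_closed_set1; apply: hausdorff_accessible.
  exact: norm_hausdorff.
have -> : range ('d sharp_fun x) = setT; last exact: closedT.
apply/seteqP; split => // y _; exists ((y : R) / dsharp x) => //.
by rewrite diff_sharp mulrC divfK.
Qed.

Lemma moore_penrose_sharp (x y : L) : dsharp x != 0 ->
  moore_penrose ('d sharp_fun x) y = ((y : R) / dsharp x) :> R.
Proof.
move=> d0; set z : L := (y : R) / dsharp x.
suff : moore_penrose ('d sharp_fun x) y = z by [].
have -> : y = 'd sharp_fun x z by rewrite diff_sharp /z mulrC divfK.
apply: (@moore_penroseK _ _ _ _ ('d sharp_fun x)); split.
- by apply: diff_continuous; exact: differentiable_sharp.
- move=> u v; rewrite !diff_sharp => /(mulfI d0) //.
- exact: closed_range_diff_sharp.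
Qed.

Lemma opnorm_diff_sharp (x y : L) :
  opnorm ('d sharp_fun x \- 'd sharp_fun y) <= K * `| `|y : R| `^ p - `|x : R| `^ p|.
Proof.
apply: opnorm_le => [|h]; first by rewrite mulr_ge0 // ltW.
have e : ('d sharp_fun x h : R) - ('d sharp_fun y h : R)
    = K * (`|y : R| `^ p - `|x : R| `^ p) * (h : R).
  transitivity (dsharp x * (h : R) - dsharp y * (h : R)); last first.
    by rewrite /dsharp; ring.
  by congr (_ - _); exact: diff_sharp.
suff : `|('d sharp_fun x h : R) - ('d sharp_fun y h : R)|
    <= K * `| `|y : R| `^ p - `|x : R| `^ p| * `|h : R| by [].
by rewrite e !normrM (ger0_norm (ltW K0)).
Qed.

(** Continuity of the derivative, by way of [opnorm_diff_sharp]. *)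
Lemma opnorm_bound_cvg (x : R) :
  K * `| `|x| `^ p - `|y| `^ p| @[y --> x] --> (0 : R).
Proof.
have -> : (0 : R) = K * `| `|x| `^ p - `|x| `^ p| by rewrite subrr normr0 mulr0.
apply: cvgM; first exact: cvg_cst.
apply: cvg_norm; apply: cvgB; first exact: cvg_cst.
exact: continuous_norm_powR.
Qed.

(** With the whole line as domain, any prescribed [kappa] is attained by taking
    it as the outer radius. *)
Lemma kappa_of_setT : kappa_of [set: L] 0 kappa = kappa.
Proof.
rewrite /kappa_of; set E := [set t | _].
have E0 : E 0 by split => //; rewrite lexx.
have ubE : ubound E kappa by move=> t [/andP[_ /ltW]].
apply/le_anti/andP; split; first by apply: ge_sup => //; exists 0.
rewrite leNgt; apply/negP => sk.
have s0 : 0 <= sup E by apply: ub_le_sup => //; exists kappa.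
have : (sup E + kappa) / 2 <= sup E.
  apply: ub_le_sup; first by exists kappa.
  by split => //; apply/andP; split; lra.
lra.
Qed.

Lemma holder_problem_sharp : holder_problem [set: L] sharp_fun 0 kappa K p.
Proof.
have dsh0 : dsharp 0 = 1 by rewrite /dsharp normr0 powR0 ?gt_eqF // mulr0 subr0.
have d0 : dsharp 0 != 0 by rewrite dsh0 oner_eq0.
split => //.
- exact: openT.
- by move=> x _; exact: differentiable_sharp.
- move=> x _.
  apply: (@squeeze_cvgr _ _ _ _ (fun=> 0)
    (fun y : R => K * `| `|x : R| `^ p - `|y| `^ p|)).
  + near=> y; rewrite opnorm_diff_sharp andbT opnorm_ge0 //.
    by apply: hboundedB; exact: diff_sharp_hbounded.
  + exact: cvg_cst.
  + exact: opnorm_bound_cvg.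
- by move=> x _; exact: closed_range_diff_sharp.
- by rewrite /sharp_fun mul0r mulr0 subr0.
- by move=> u v; rewrite !diff_sharp dsh0 !mul1r.
- move=> x tau _ /andP[t0 t1].
  have mp1 : opnorm (moore_penrose ('d sharp_fun (0 : L))) <= 1.
    apply: opnorm_le => // y.
    by rewrite mul1r !hnorm_line moore_penrose_sharp // dsh0 divr1.
  set y := 0 + _.
  have yE : y = tau * (x : R) :> R by rewrite /y add0r subr0.
  have o1 := opnorm_diff_sharp x y.
  have o0 : 0 <= opnorm ('d sharp_fun x \- 'd sharp_fun y).
    by apply: opnorm_ge0; apply: hboundedB; exact: diff_sharp_hbounded.
  apply: (le_trans (ler_wpM2r o0 mp1)); rewrite mul1r; apply: (le_trans o1).
  rewrite yE normrM powRM // (ger0_norm t0) subr0 hnorm_line.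
  have tp : tau `^ p <= 1.
    have -> : 1 = 1 `^ p :> R by rewrite powR1.
    by rewrite ge0_ler_powR ?nnegrE // ltW.
  have h : 0 <= (1 - tau `^ p) * `|x : R| `^ p by rewrite mulr_ge0 ?subr_ge0 ?powR_ge0.
  rewrite -normrN opprB -{1}[`|x : R| `^ p]mul1r -mulrBl (ger0_norm h).
  by rewrite mulrA.
Unshelve. all: by end_near. Qed.

Let rho : R := ((p + 1) / ((2 * p + 1) * K)) `^ p^-1.

Lemma powR_rho : rho `^ p = (p + 1) / ((2 * p + 1) * K).
Proof.
rewrite /rho -powRrM mulVf ?powRr1 // ?gt_eqF //.
by rewrite divr_ge0 ?mulr_ge0 ?addr_ge0 ?mulr_ge0 // ltW.
Qed.

Lemma rho_gt0 : 0 < rho.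
Proof. by rewrite powR_gt0 // divr_gt0 ?mulr_gt0 ?addr_gt0 ?mulr_gt0. Qed.

(** At distance [rho] from 0 the derivative is p / (2 p + 1) and the value is
    2 p x / (2 p + 1), so the Newton correction is 2 x. *)
Lemma newton_reflects (x : L) : `|x : R| = rho ->
  x - moore_penrose ('d sharp_fun x) (sharp_fun x) = - x.
Proof.
move=> xr; have p2 : 0 < 2 * p + 1 by rewrite addr_gt0 // mulr_gt0.
have dx : dsharp x = p / (2 * p + 1).
  by rewrite /dsharp xr powR_rho; field; rewrite !gt_eqF.
have -> : moore_penrose ('d sharp_fun x) (sharp_fun x) = (2 * (x : R)) :> R.
  rewrite moore_penrose_sharp dx ?gt_eqF ?divr_gt0 //.
  by rewrite /sharp_fun xr powR_rho; field; rewrite !gt_eqF.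
by rewrite (_ : 2 * (x : R) = x + x :> R) ?opprD ?addrA ?subrr ?add0r //; ring.
Qed.

Lemma convergence_radius_le rho' :
  convergence_radius RealScalars K p kappa rho' -> rho' <= rho.
Proof.
move=> cr; rewrite leNgt; apply/negP => rr.
have r0 := rho_gt0.
have [||_ xcv] := cr L L setT sharp_fun 0 kappa holder_problem_sharp kappa_of_setT rho.
- by rewrite /hball /mkset subr0 hnorm_line ger0_norm // ltW.
- by move=> r00; move: r0; rewrite r00 ltxx.
have norm_rho k : `|gauss_newton sharp_fun (rho : L) k : R| = rho.
  elim: k => [|k IH]; first by rewrite ger0_norm // ltW.
  have -> : gauss_newton sharp_fun (rho : L) k.+1 =
    - gauss_newton sharp_fun (rho : L) k by exact: newton_reflects.
  by rewrite normrN.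
have /hcvgP/(_ rho r0)[N /(_ N (leqnn N))] := xcv.
by rewrite subr0 hnorm_line norm_rho ltxx.
Qed.

End SharpExample.

(** * The convergence theorem *)

Theorem theorem13 (R : realType) (c : scalar_kind) (X Y : hilbert R c)
    (Omega : set X) (F : X -> Y) (xs : X) (rad K p : R)
    (hF : holder_problem Omega F xs rad K p) :
  let kappa := kappa_of Omega xs rad in
  let rho := ((p + 1) / ((2 * p + 1) * K)) `^ p^-1 in
  let r := Num.min kappa rho in
  (forall x0 : X, hball xs r x0 -> x0 <> xs ->
    let x := gauss_newton F x0 in
    let e := fun k => hnorm (x k - xs) in
    let t := majorant_seq K p (hnorm (x0 - xs)) in
    gauss_newton_defined Omega F x0 /\
    (forall k, (p + 1) * (1 - K * t k `^ p) != 0) /\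
    (forall k, t k.+1 < t k) /\
    (forall k, 0 < t k < r) /\
    (t k @[k --> \oo] --> (0 : R)) /\
    (forall k, hball xs r (x k)) /\
    (x k @[k --> \oo] --> xs) /\
    (forall k,
      e k.+1 <= K * p / ((p + 1) * (1 - K * t k `^ p)) * e k `^ (p + 1) /\
      K * p / ((p + 1) * (1 - K * t k `^ p)) * e k `^ (p + 1)
        <= K * p / ((p + 1) * (1 - K * hnorm (x0 - xs) `^ p)) * e k `^ (p + 1)) /\
    (forall k,
      e k <= (K * p * hnorm (x0 - xs) `^ p
                / ((p + 1) * (1 - K * hnorm (x0 - xs) `^ p)))
               `^ (((p + 1) ^+ k - 1) / p) * hnorm (x0 - xs))) /\
  (forall x : X, hball xs kappa x -> hball xs (((p + 1) / K) `^ p^-1) x ->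
    F x = 0 -> x = xs) /\
  (rho < kappa -> best_convergence_radius K p kappa rho).
Proof.
move=> kappa rho r; have K0 := hp_K hF.
have p01 := hp_p hF; have /andP[p0 _] := p01.
have p1 : 0 < p + 1 by rewrite addr_gt0.
split; [|split].
- move=> x0 x0r x0xs x e t.
  have /andP[x0k x0rho] : (hnorm (x0 - xs) < kappa) && (hnorm (x0 - xs) < rho).
    by rewrite -lt_min.
  have t0 : 0 < hnorm (x0 - xs).
    by apply: hnorm_gt0 => /eqP; rewrite subr_eq0 => /eqP.
  have t0_lt := lt_radius_cond K0 p0 (ltW t0) x0rho.
  have tr k : 0 < t k < r.
    have /andP[-> tk] := majorant_bounds K0 p0 t0 t0_lt k.
    by rewrite /r lt_min !(le_lt_trans tk).
  have e0 k : 0 <= e k by exact: hnorm_ge0.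
  have et := error_le_majorant hF x0k x0xs t0_lt.
  have step k (_ : e k <= t k) := error_recurrence hF x0k x0xs t0_lt (et k).
  split; first exact: (iterates_defined hF x0k x0xs t0_lt).
  split.
    move=> k; rewrite mulf_neq0 ?gt_eqF // subr_gt0.
    exact: (majorant_Klt1 K0 p0 t0 t0_lt).
  split; first exact: (majorant_decr K0 p0 t0 t0_lt).
  split=> //.
  split; first exact: (majorant_cvg K0 p0 t0 t0_lt).
  split.
    by move=> k; apply: le_lt_trans (et k) _; have /andP[] := tr k.
  split; first exact: (iterates_cvg hF x0k x0xs t0_lt).
  split=> k.
    split; first exact: (error_step_majorant K0 p0 t0 t0_lt e0 erefl step k).
    exact: (majorant_factor_le K0 p0 t0 t0_lt e k).
  rewrite (mulrAC (K * p)).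
  exact: (error_superlinear K0 p0 t0 t0_lt e0 erefl step k).
- move=> x xk; rewrite /hball /= powR_root_lt ?hnorm_ge0 ?divr_gt0 //.
  rewrite ltr_pdivlMr // mulrC => Kx; exact: (zero_unique hF xk Kx).
- move=> rk; split=> [c' X' Y' O' F' xs' rad' h' kE x0 x0r x0xs|rho'].
    have x0k : hball xs' (kappa_of O' xs' rad') x0.
      by rewrite kE; exact: lt_trans x0r rk.
    have t0_lt := lt_radius_cond K0 p0 (hnorm_ge0 _) x0r.
    split; first exact: (iterates_defined h' x0k x0xs t0_lt).
    exact: (iterates_cvg h' x0k x0xs t0_lt).
  apply: convergence_radius_le => //; apply: lt_trans rk.
  by rewrite powR_gt0 // divr_gt0 // mulr_gt0 // addr_gt0 // mulr_gt0.
Qed.
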